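(* Let $m,k\in\mathbb{N}$, let $\mathfrak{M}\subset(L^2)^m$ be a doubly invariant subspace, let $\sigma\in(L^\infty)^{m\times m}$ be the matrix with $M_\sigma=P_{\mathfrak{M}}$, and let $\vec g_j\in\mathfrak{M}$ for $j=1,\dots,k$. Consider the family $$\mathcal{F}=\{U^n\vec g_j:\ n\in\mathbb{Z},\ 1\le j\le k\}.$$ (a) $\mathcal{F}$ is a Bessel sequence if and only if there are $\vec f_j\in(L^\infty)^m$ with $\vec g_j=M_\sigma\vec f_j$ for all $1\le j\le k$. (b) $\mathcal{F}$ is a frame for $\mathfrak{M}$ if and only if $F:=[\vec f_1,\dots,\vec f_k]\in(L^\infty)^{m\times k}$ (with columns $\vec f_j$ as in (a)) satisfies the following equivalent conditions, where $\beta=I_{\mathbb{C}^m}-\sigma$: (1) there is $\delta>0$ such that $M_{FF^*}\ge\delta^2I_{(L^2)^m}$ on $\mathfrak{M}$, i.e. $\langle FF^*\vec h,\vec h\rangle\ge\delta^2\|\vec h\|^2$ for all $\vec h\in\mathfrak{M}$; (2) there is $\eta>0$ such that $F(z)F^*(z)+\beta(z)\ge\eta^2I_{\mathbb{C}^m}$ for a.e. $z\in\mathbb{T}$.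
   Context: $\mathbb{T}$ is the unit circle, $L^2=L^2(\mathbb{T})$, $L^\infty=L^\infty(\mathbb{T})$, and $(L^2)^m=L^2(\mathbb{T},\mathbb{C}^m)$ (column vectors). $U$ is multiplication by $z$ on $(L^2)^m$ (bilateral shift of multiplicity $m$). A closed subspace $\mathfrak{M}\subset(L^2)^m$ is doubly invariant if $\mathfrak{M}$ and $\mathfrak{M}^\perp$ are both $U$-invariant. For a bounded matrix function $G\in(L^\infty)^{m\times k}$, $M_G:(L^2)^k\to(L^2)^m$ is multiplication $M_G\vec h=G\vec h$, and $G^*$ is the pointwise conjugate transpose. $P_{\mathfrak{M}}$ is the orthogonal projection of $(L^2)^m$ onto $\mathfrak{M}$. For a doubly invariant $\mathfrak{M}$ there is a unique $\sigma\in(L^\infty)^{m\times m}$, whose values are a.e. orthogonal projection matrices, with $M_\sigma=P_{\mathfrak{M}}$. A countable indexed family $\{x_i\}$ in a Hilbert space $\mathcal{H}$ is a Bessel sequence if there is $B>0$ with $\sum_i|\langle h,x_i\rangle|^2\le B\|h\|^2$ for all $h\in\mathcal{H}$, and a frame for $\mathcal{H}$ if moreover there is $A>0$ with $A\|h\|^2\le\sum_i|\langle h,x_i\rangle|^2$ for all $h\in\mathcal{H}$; here $\mathcal{H}=\mathfrak{M}$. *)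

(* Defs.v *)
From HB Require Import structures.
From mathcomp Require Import all_boot all_order all_algebra.
From mathcomp Require Import all_classical all_reals all_analysis.
From mathcomp Require Import measurable_realfun spectral complex.

Set Implicit Arguments.
Unset Strict Implicit.
Unset Printing Implicit Defensive.
Import Order.TTheory GRing.Theory Num.Theory.
Import numFieldNormedType.Exports.

Local Open Scope classical_set_scope.
Local Open Scope ring_scope.
Local Open Scope complex_scope.
Local Open Scope sesquilinear_scope.

Section circle.
Variable R : realType.

Definition circle_pt : Type := {z : R[i] | `|z| == 1}.

HB.instance Definition _ := Choice.on circle_pt.

Definition circle_pt1 : circle_pt := exist _ 1 (introT eqP (normr1 _)).

HB.instance Definition _ := isPointed.Build circle_pt circle_pt1.

Definition circle_coord (z : circle_pt) : R * R :=
  (complex.Re (sval z), complex.Im (sval z)).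

(* The unit circle with the trace of the Borel sigma-algebra of the plane. *)
Definition circle := g_sigma_algebra_preimageType circle_coord.

HB.instance Definition _ := Measurable.on circle.

Lemma norm_cis (x : R) : `|cos x +i* sin x| == 1 :> R[i].
Proof. by rewrite normc_def /= cos2Dsin2 sqrtr1. Qed.

(* t |-> e^{2 i pi t} *)
Definition circle_exp (t : R) : circle :=
  exist _ (cos (2 * pi * t) +i* sin (2 * pi * t)) (norm_cis (2 * pi * t)).

Lemma measurable_circle_exp : measurable_fun setT circle_exp.
Proof.
have mc : measurable_fun setT (circle_coord \o circle_exp).
  apply/measurable_fun_pairP; split; rewrite /comp /=.
    apply: (measurableT_comp (f := @cos R)).
      exact: (continuous_measurable_fun (@continuous_cos R)).
    exact: measurable_funM.
  apply: (measurableT_comp (f := @sin R)).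
    exact: (continuous_measurable_fun (@continuous_sin R)).
  exact: measurable_funM.
move=> _ _ [B mB <-].
by have := mc measurableT B mB; rewrite !setTI.
Qed.

(* Normalized arc length: the image of the Lebesgue measure on [0, 1[
   under circle_exp. *)
Definition circle_measure : set circle -> \bar R :=
  pushforward (mrestr (@lebesgue_measure R)
                 (measurable_itv `[(0 : R), 1[)) circle_exp.

HB.instance Definition _ := Measure.copy circle_measure
  (measure_function_pushforward__canonical__measure_function_Measure
    (mrestr (@lebesgue_measure R) (measurable_itv `[(0 : R), 1[))
    measurable_circle_exp).

(* Functions are complex-matrix valued; m x 1 matrices are column vectors.
   No quotient by almost everywhere equality is taken: identities in L^2 are
   stated with %[ae circle_measure], and closed subspaces of L^2 are
   automatically stable under almost everywhere equality. *)

Definition cmeasurable (f : circle -> R[i]) :=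
  measurable_fun setT (fun z => complex.Re (f z)) /\
  measurable_fun setT (fun z => complex.Im (f z)).

Definition cintegral (f : circle -> R[i]) : R[i] :=
  (\int[circle_measure]_z complex.Re (f z)) +i*
  (\int[circle_measure]_z complex.Im (f z)).

Definition Linfty m k (G : circle -> 'M[R[i]]_(m, k)) :=
  (forall i j, cmeasurable (fun z => G z i j)) /\
  exists C : R, forall i j,
    {ae circle_measure, forall z, Normc.normc (G z i j) <= C}.

Definition L2normsq m (h : circle -> 'cV[R[i]]_m) : \bar R :=
  (\int[circle_measure]_z
     (\sum_(i < m) Normc.normc (h z i ord0) ^+ 2)%:E)%E.

Definition L2 m : set (circle -> 'cV[R[i]]_m) :=
  [set h : circle -> 'cV[R[i]]_m | (forall i, cmeasurable (fun z => h z i ord0)) /\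
    (L2normsq h < +oo)%E].

(* Linear in the first argument. *)
Definition L2inner m (f g : circle -> 'cV[R[i]]_m) : R[i] :=
  cintegral (fun z => ((g z ^t*) *m f z) ord0 ord0).

Record closed_subspace m (M : set (circle -> 'cV[R[i]]_m)) : Prop := {
  closed_subspaceL2 : M `<=` @L2 m ;
  closed_subspace0 : M (fun=> 0) ;
  closed_subspaceD : forall f g, M f -> M g -> M (fun z => f z + g z) ;
  closed_subspaceZ : forall (c : R[i]) f, M f -> M (fun z => c *: f z) ;
  closed_subspace_lim : forall (u : nat -> circle -> 'cV[R[i]]_m) f,
    (forall n, M (u n)) -> L2 f ->
    L2normsq (fun z => u n z - f z) @[n --> \oo] --> 0%E -> M f }.

Definition orthocomp m (M : set (circle -> 'cV[R[i]]_m)) :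
    set (circle -> 'cV[R[i]]_m) :=
  [set h | L2 h /\ forall f, M f -> L2inner h f = 0].

(* U ^ n, for n an integer, is the multiplication by z ^ n. *)
Definition Ushift m (n : int) (h : circle -> 'cV[R[i]]_m) :
    circle -> 'cV[R[i]]_m :=
  fun z => sval z ^ n *: h z.

Definition doubly_invariant m (M : set (circle -> 'cV[R[i]]_m)) :=
  [/\ closed_subspace M,
      forall h, M h -> M (Ushift 1 h) &
      forall h, orthocomp M h -> orthocomp M (Ushift 1 h)].

Definition mulop m k (G : circle -> 'M[R[i]]_(m, k))
    (h : circle -> 'cV[R[i]]_k) : circle -> 'cV[R[i]]_m :=
  fun z => G z *m h z.

Definition is_orthoproj m (M : set (circle -> 'cV[R[i]]_m))
    (P : (circle -> 'cV[R[i]]_m) -> circle -> 'cV[R[i]]_m) :=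
  forall h, L2 h -> M (P h) /\ orthocomp M (fun z => h z - P h z).

Definition frame_energy m (I : choiceType)
    (x : I -> circle -> 'cV[R[i]]_m) (h : circle -> 'cV[R[i]]_m) : \bar R :=
  \esum_(i in [set: I]) (Normc.normc (L2inner h (x i)) ^+ 2)%:E.

Definition bessel m (M : set (circle -> 'cV[R[i]]_m)) (I : choiceType)
    (x : I -> circle -> 'cV[R[i]]_m) :=
  exists2 B : R, 0 < B &
    forall h, M h -> (frame_energy x h <= B%:E * L2normsq h)%E.

Definition frame m (M : set (circle -> 'cV[R[i]]_m)) (I : choiceType)
    (x : I -> circle -> 'cV[R[i]]_m) :=
  bessel M x /\
  exists2 A : R, 0 < A &
    forall h, M h -> (A%:E * L2normsq h <= frame_energy x h)%E.

Definition shift_family m k (g : 'I_k -> circle -> 'cV[R[i]]_m) :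
    int * 'I_k -> circle -> 'cV[R[i]]_m :=
  fun nj => Ushift nj.1 (g nj.2).

Definition mx_of_cols m k (f : 'I_k -> circle -> 'cV[R[i]]_m) :
    circle -> 'M[R[i]]_(m, k) :=
  fun z => \matrix_(i, j) f j z i ord0.

Definition mxadj m k (G : circle -> 'M[R[i]]_(m, k)) :
    circle -> 'M[R[i]]_(k, m) :=
  fun z => G z ^t*.

End circle.

(* A >= B in the Loewner order; recall that 0 <= c in R[i] means that c is a
   nonnegative real. *)
Definition loewner_ge (R : realType) m (A B : 'M[R[i]]_m) :=
  forall v : 'cV[R[i]]_m, 0 <= ((v ^t*) *m (A - B) *m v) ord0 ord0.

(* Main.v *)
(* The n-sum in the frame energy of h is, by Parseval, the integral of
   |g_j^* h|^2. Testing the Bessel inequality on indicators times g_j therefore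
   bounds |g_j| almost everywhere, so one may take f_j = g_j. Conversely, if
   g_j = sigma f_j, then g_j^* h = f_j^* h for h in M, and the frame energy is
   the quadratic form <F F^* h, h>; hence (1) is the lower frame bound. Testing
   (1) on h = sigma 1_E v, for v in a countable dense set, makes it pointwise on
   the range of sigma(z); the summand beta takes care of the orthogonal
   complement of that range.

   Parseval reduces to the density of trigonometric polynomials: the bounded L2
   limits of trigonometric polynomials form an algebra closed under bounded
   pointwise limits, so the sets with indicator in it form a sigma-algebra,
   which contains the arcs { Re z > a } and { Im z > a }. *)
Require Import Defs.
From mathcomp Require Import all_boot all_order all_algebra.
From mathcomp Require Import all_classical all_reals all_analysis.
From mathcomp Require Import complex.
From mathcomp Require Import measurable_realfun spectral.
From mathcomp Require Import ring lra.

Set Implicit Arguments.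
Unset Strict Implicit.
Unset Printing Implicit Defensive.
Import Order.TTheory GRing.Theory Num.Theory.
Import numFieldNormedType.Exports.

Local Open Scope classical_set_scope.
Local Open Scope ring_scope.
Local Open Scope complex_scope.

(** * Complex L2 functions on the circle *)

(** Localization is what makes the tests legitimate. The projection onto [M] multiplies by [sigma]
    pointwise, so an indicator times an element of [M] is again fixed by [sigma] almost everywhere,
    and closedness puts it back in [M]. Integrated inequalities thereby become pointwise ones. That
    the values of [sigma] are projection matrices is derived from M_sigma = P_M.

    Two obstacles shape the estimates. The [g j] are only square integrable at the start, so |g_j|^2
    need not be, and Parseval cannot be applied to it directly; hence the truncation at level N,
    harmless because the resulting bound does not depend on N. Moreover F = sigma F is not assumed,
    so F^* v mixes the range of sigma with its complement; going from (1) to (2) therefore costs a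
    factor depending on a bound K of F^*, which is the origin of [2 * K + 3]. *)

Section complex_L2.
Variable R : realType.
Local Notation mu := (@circle_measure R).
Local Notation C := (R[i]).
Implicit Types f g : circle R -> C.

(* [`|w| ^ 2], as a polynomial in the coordinates. *)
Definition nsq (w : C) : R := complex.Re w ^+ 2 + complex.Im w ^+ 2.

Lemma nsqE w : nsq w = Normc.normc w ^+ 2.
Proof. by case: w => a b /=; rewrite sqr_sqrtr // addr_ge0 // sqr_ge0. Qed.

Lemma nsq_ge0 w : 0 <= nsq w.
Proof. by rewrite addr_ge0 // sqr_ge0. Qed.

Lemma nsq0 : nsq 0 = 0. Proof. by rewrite /nsq /= expr0n addr0. Qed.

Lemma nsq_eq0 w : nsq w = 0 -> w = 0.
Proof.
case: w => a b /eqP; rewrite /nsq /= paddr_eq0 ?sqr_ge0 // !sqrf_eq0.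
by case/andP => /eqP -> /eqP ->.
Qed.

Lemma nsqM v w : nsq (v * w) = nsq v * nsq w.
Proof. by case: v => a b; case: w => c d; rewrite /nsq /=; ring. Qed.

Lemma nsqN w : nsq (- w) = nsq w.
Proof. by case: w => a b; rewrite /nsq /=; ring. Qed.

Lemma nsq_conj w : nsq (Num.conj w) = nsq w.
Proof. by case: w => a b; rewrite /nsq /= sqrrN. Qed.

Lemma nsq_real (r : R) : nsq r%:C = r ^+ 2.
Proof. by rewrite /nsq /= expr0n addr0. Qed.

Lemma nsqD_le v w : nsq (v + w) <= 2 * nsq v + 2 * nsq w.
Proof.
case: v => a b; case: w => c d; rewrite /nsq /=.
have := sqr_ge0 (a - c); have := sqr_ge0 (b - d); nra.
Qed.

(** The factor [2 ^+ size s] comes from iterating [nsqD_le]; it is far from sharp, but only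
    boundedness is wanted from it. *)
Lemma nsq_sum_le (I : Type) (s : seq I) (F : I -> C) :
  nsq (\sum_(i <- s) F i) <= 2 ^+ size s * \sum_(i <- s) nsq (F i).
Proof.
elim: s => [|i s IH]; first by rewrite !big_nil nsq0 mulr0.
rewrite !big_cons /= exprS mulrDr; apply: le_trans (nsqD_le _ _) _.
have h1 : 1 <= 2 ^+ size s :> R by rewrite exprn_ege1 // ler1n.
rewrite lerD //; last by rewrite -mulrA ler_pM2l.
by rewrite ler_wpM2r ?nsq_ge0 // ler_peMr.
Qed.

Lemma conjM_nsq w : w * Num.conj w = (nsq w)%:C.
Proof. by case: w => a b; congr (_ +i* _); rewrite /nsq /=; ring. Qed.

Lemma cmeasurable_cst (c : C) : cmeasurable (fun _ : circle R => c).
Proof. by split; exact: measurable_cst. Qed.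

Lemma cmeasurableD f g : cmeasurable f -> cmeasurable g ->
  cmeasurable (fun z => f z + g z).
Proof.
move=> [f1 f2] [g1 g2]; split.
- under eq_fun do rewrite raddfD; exact: measurable_funD.
- under eq_fun do rewrite raddfD; exact: measurable_funD.
Qed.

Lemma cmeasurableM f g : cmeasurable f -> cmeasurable g ->
  cmeasurable (fun z => f z * g z).
Proof.
move=> [f1 f2] [g1 g2]; split.
- rewrite (_ : (fun _ => _) = (fun z => complex.Re (f z) * complex.Re (g z) -
     complex.Im (f z) * complex.Im (g z))); last first.
    by apply/funext => z; case: (f z) => a b; case: (g z).
  by apply: measurable_funB; apply: measurable_funM.
- rewrite (_ : (fun _ => _) = (fun z => complex.Re (f z) * complex.Im (g z) +
     complex.Im (f z) * complex.Re (g z))); last first.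
    by apply/funext => z; case: (f z) => a b; case: (g z) => c d /=.
  by apply: measurable_funD; apply: measurable_funM.
Qed.

Lemma cmeasurable_conj f : cmeasurable f ->
  cmeasurable (fun z => Num.conj (f z)).
Proof.
move=> [f1 f2]; split.
- by rewrite (_ : (fun _ => _) = (fun z => complex.Re (f z))) //;
    apply/funext => z; case: (f z).
- rewrite (_ : (fun _ => _) = (fun z => - complex.Im (f z))); last first.
    by apply/funext => z; case: (f z).
  exact: measurable_funN.
Qed.

Lemma cmeasurableN f : cmeasurable f -> cmeasurable (fun z => - f z).
Proof.
move=> mf; under eq_fun do rewrite -mulN1r.
exact: cmeasurableM (cmeasurable_cst _) mf.
Qed.

Lemma cmeasurableB f g : cmeasurable f -> cmeasurable g ->
  cmeasurable (fun z => f z - g z).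
Proof. by move=> mf /cmeasurableN; exact: cmeasurableD. Qed.

Lemma cmeasurable_sum (I : Type) (s : seq I) (F : I -> circle R -> C) :
  (forall i, cmeasurable (F i)) -> cmeasurable (fun z => \sum_(i <- s) F i z).
Proof.
move=> mF; elim: s => [|i s IH].
  by under eq_fun do rewrite big_nil; exact: cmeasurable_cst.
by under eq_fun do rewrite big_cons; exact: cmeasurableD.
Qed.

Lemma cmeasurable_real (u : circle R -> R) : measurable_fun setT u ->
  cmeasurable (fun z => (u z)%:C).
Proof. by move=> mu_; split => //=; exact: measurable_cst. Qed.

Lemma measurable_nsq f : cmeasurable f -> measurable_fun setT (fun z => nsq (f z)).
Proof.
by case=> f1 f2; apply: measurable_funD; apply: measurable_funX.
Qed.

Definition cintegrable f :=
  mu.-integrable setT (EFin \o (fun z => complex.Re (f z))) /\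
  mu.-integrable setT (EFin \o (fun z => complex.Im (f z))).

Lemma cintegrableD f g : cintegrable f -> cintegrable g ->
  cintegrable (fun z => f z + g z).
Proof.
move=> [f1 f2] [g1 g2]; split.
- apply: eq_integrable (integrableD _ f1 g1) => // z _ /=.
  by rewrite raddfD EFinD.
- apply: eq_integrable (integrableD _ f2 g2) => // z _ /=.
  by rewrite raddfD EFinD.
Qed.

Lemma cintegralD f g : cintegrable f -> cintegrable g ->
  cintegral (fun z => f z + g z) = cintegral f + cintegral g.
Proof.
move=> [f1 f2] [g1 g2]; rewrite /cintegral; congr (_ +i* _).
- by under eq_Rintegral do rewrite raddfD; rewrite RintegralD.
- by under eq_Rintegral do rewrite raddfD; rewrite RintegralD.
Qed.

Lemma cintegralZ (c : C) f : cintegrable f ->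
  cintegral (fun z => c * f z) = c * cintegral f.
Proof.
case: c => a b [f1 f2]; rewrite /cintegral; congr (_ +i* _).
- transitivity (\int[mu]_z (a * complex.Re (f z) - b * complex.Im (f z))).
    by apply: eq_Rintegral => z _; case: (f z).
  rewrite RintegralB ?RintegralZl //.
  + exact: (integrableZl _ a f1).
  + exact: (integrableZl _ b f2).
- transitivity (\int[mu]_z (a * complex.Im (f z) + b * complex.Re (f z))).
    by apply: eq_Rintegral => z _; case: (f z) => x y /=.
  rewrite RintegralD ?RintegralZl //.
  + exact: (integrableZl _ a f2).
  + exact: (integrableZl _ b f1).
Qed.

Lemma cintegral_conj f : cintegrable f ->
  cintegral (fun z => Num.conj (f z)) = Num.conj (cintegral f).
Proof.
move=> [f1 f2]; rewrite /cintegral; congr (_ +i* _).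
- by apply: eq_Rintegral => z _; case: (f z).
- rewrite -mulN1r -RintegralZl //.
  by apply: eq_Rintegral => z _; case: (f z) => x y /=; rewrite mulN1r.
Qed.

Lemma cintegrable0 : cintegrable (fun=> 0).
Proof. by split; apply: integrable0. Qed.

Lemma cintegral0 : cintegral (fun=> 0 : C) = 0.
Proof. by rewrite /cintegral /= /Rintegral integral0. Qed.

Lemma cintegrable_sum (I : Type) (s : seq I) (F : I -> circle R -> C) :
  (forall i, cintegrable (F i)) -> cintegrable (fun z => \sum_(i <- s) F i z).
Proof.
move=> iF; elim: s => [|i s IH].
  by under eq_fun do rewrite big_nil; exact: cintegrable0.
by under eq_fun do rewrite big_cons; exact: cintegrableD.
Qed.

Lemma cintegral_sum (I : Type) (s : seq I) (F : I -> circle R -> C) :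
  (forall i, cintegrable (F i)) ->
  cintegral (fun z => \sum_(i <- s) F i z) = \sum_(i <- s) cintegral (F i).
Proof.
move=> iF; elim: s => [|i s IH].
  by rewrite big_nil; under eq_fun do rewrite big_nil; exact: cintegral0.
rewrite big_cons -IH; under eq_fun do rewrite big_cons.
by rewrite cintegralD //; exact: cintegrable_sum.
Qed.

Definition sqint f : \bar R := (\int[mu]_z (nsq (f z))%:E)%E.

Definition L2c f := cmeasurable f /\ (sqint f < +oo)%E.

Lemma sqint_ge0 f : (0 <= sqint f)%E.
Proof. by apply: integral_ge0 => z _; rewrite lee_fin nsq_ge0. Qed.

Lemma integrable_nsq f : L2c f ->
  mu.-integrable setT (EFin \o (fun z => nsq (f z))).
Proof.
move=> [mf f_fin]; apply/integrableP; split.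
  by apply/measurable_EFinP; exact: measurable_nsq.
rewrite (eq_integral (fun z => (nsq (f z))%:E)) // => z _ /=.
by rewrite ger0_norm // nsq_ge0.
Qed.

Lemma sqint_fineK f : L2c f -> (fine (sqint f))%:E = sqint f.
Proof. by move=> [_ f_fin]; rewrite fineK // ge0_fin_numE // sqint_ge0. Qed.

Lemma L2c_dominated f (u : circle R -> R) : cmeasurable f ->
  mu.-integrable setT (EFin \o u) -> (forall z, nsq (f z) <= u z) -> L2c f.
Proof.
move=> mf iu fu; split=> //.
apply: le_lt_trans (integrable_lty _ iu) => //.
apply: ge0_le_integral => //.
- by move=> z _; rewrite lee_fin nsq_ge0.
- by apply/measurable_EFinP; exact: measurable_nsq.
- exact: measurable_int iu.
- by move=> z _; rewrite lee_fin.
Qed.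

Lemma L2cD f g : L2c f -> L2c g -> L2c (fun z => f z + g z).
Proof.
move=> Lf Lg.
apply: (@L2c_dominated _ (fun z => 2 * nsq (f z) + 2 * nsq (g z))).
- exact: cmeasurableD Lf.1 Lg.1.
- apply: eq_integrable (integrableD _ (integrableZl _ 2 (integrable_nsq Lf))
    (integrableZl _ 2 (integrable_nsq Lg))) => // z _ /=.
- by move=> z; exact: nsqD_le.
Qed.

Lemma L2cM_bounded f g (B : R) : cmeasurable f -> (forall z, nsq (f z) <= B) ->
  L2c g -> L2c (fun z => f z * g z).
Proof.
move=> mf fB Lg.
apply: (@L2c_dominated _ (fun z => B * nsq (g z))).
- exact: cmeasurableM Lg.1.
- exact: eq_integrable (integrableZl _ B (integrable_nsq Lg)).
- by move=> z; rewrite nsqM ler_wpM2r // nsq_ge0.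
Qed.

Lemma L2cZ (c : C) f : L2c f -> L2c (fun z => c * f z).
Proof. by apply: (@L2cM_bounded _ _ (nsq c)) => //; exact: cmeasurable_cst. Qed.

Lemma L2cN f : L2c f -> L2c (fun z => - f z).
Proof. by move=> /(L2cZ (-1)); under eq_fun do rewrite mulN1r. Qed.

Lemma L2cB f g : L2c f -> L2c g -> L2c (fun z => f z - g z).
Proof. by move=> Lf /L2cN; exact: L2cD. Qed.

Lemma L2c0 : L2c (fun=> 0).
Proof.
split; first exact: cmeasurable_cst.
by rewrite /sqint nsq0 integral0.
Qed.

Lemma L2c_sum (I : Type) (s : seq I) (F : I -> circle R -> C) :
  (forall i, L2c (F i)) -> L2c (fun z => \sum_(i <- s) F i z).
Proof.
move=> LF; elim: s => [|i s IH].
  by under eq_fun do rewrite big_nil; exact: L2c0.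
by under eq_fun do rewrite big_cons; exact: L2cD.
Qed.

(** Both coordinates of the product are dominated by |f|^2 + |g|^2. The comparison is made between
    squares, where [nsqM] makes it polynomial. *)
Lemma cintegrable_mulconj f g : L2c f -> L2c g ->
  cintegrable (fun z => f z * Num.conj (g z)).
Proof.
move=> Lf Lg.
have [m1 m2] := cmeasurableM Lf.1 (cmeasurable_conj Lg.1).
have I := integrableD measurableT (integrable_nsq Lf) (integrable_nsq Lg).
have key z : (complex.Re (f z * Num.conj (g z)) ^+ 2 <= (nsq (f z) + nsq (g z)) ^+ 2)
  /\ (complex.Im (f z * Num.conj (g z)) ^+ 2 <= (nsq (f z) + nsq (g z)) ^+ 2).
  have h := nsqM (f z) (Num.conj (g z)); rewrite nsq_conj in h.
  have h1 := nsq_ge0 (f z); have h2 := nsq_ge0 (g z).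
  have p := mulr_ge0 h1 h2.
  have q1 := sqr_ge0 (complex.Re (f z * Num.conj (g z))).
  have q2 := sqr_ge0 (complex.Im (f z * Num.conj (g z))).
  rewrite {1}/nsq in h.
  have q3 := sqr_ge0 (nsq (f z)); have q4 := sqr_ge0 (nsq (g z)).
  by split; rewrite sqrrD; lra.
split; (apply: le_integrable I => //; first exact/measurable_EFinP);
  move=> z _; rewrite /= lee_fin -(@ler_pXn2r _ 2) ?nnegrE //
    !real_normK ?num_real //; have [] := key z; lra.
Qed.

Definition cip f g := cintegral (fun z => f z * Num.conj (g z)).

Lemma cipDl f g h : L2c f -> L2c g -> L2c h ->
  cip (fun z => f z + g z) h = cip f h + cip g h.
Proof.
move=> Lf Lg Lh; rewrite /cip; under eq_fun do rewrite mulrDl.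
by rewrite cintegralD //; exact: cintegrable_mulconj.
Qed.

Lemma cipZl (c : C) f h : L2c f -> L2c h ->
  cip (fun z => c * f z) h = c * cip f h.
Proof.
move=> Lf Lh; rewrite /cip; under eq_fun do rewrite -mulrA.
by rewrite cintegralZ //; exact: cintegrable_mulconj.
Qed.

Lemma cipC f g : L2c f -> L2c g -> cip f g = Num.conj (cip g f).
Proof.
move=> Lf Lg; rewrite /cip -cintegral_conj; last exact: cintegrable_mulconj.
by under [in RHS]eq_fun do rewrite rmorphM /= conjCK mulrC.
Qed.

Lemma cip_suml (I : Type) (s : seq I) (F : I -> circle R -> C) h :
  (forall i, L2c (F i)) -> L2c h ->
  cip (fun z => \sum_(i <- s) F i z) h = \sum_(i <- s) cip (F i) h.
Proof.
move=> LF Lh; rewrite /cip; under eq_fun do rewrite mulr_suml.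
by rewrite cintegral_sum // => i; exact: cintegrable_mulconj.
Qed.

Lemma cip_self f : L2c f -> cip f f = (fine (sqint f))%:C.
Proof.
move=> Lf; rewrite /cip /cintegral.
under eq_Rintegral do rewrite conjM_nsq.
under [X in _ +i* X]eq_Rintegral do rewrite conjM_nsq.
by rewrite /= {2}/Rintegral integral0.
Qed.

(** * Finite orthonormal expansions *)

Section orthonormal.
Variables (I : eqType) (e : I -> circle R -> C).
Hypothesis Le : forall i, L2c (e i).
Hypothesis orth : forall i j, cip (e i) (e j) = (i == j)%:R.

(** Completing the square in [c]. The choice [c i = cip f (e i)] gives the Bessel inequality. For
    arbitrary [c], nonnegativity of the last sum controls the norm of [f], so an approximant can be
    used whatever its coefficients are. *)
Lemma pythagoras_orthonormal (s : seq I) (c : I -> C) f : uniq s -> L2c f ->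
  fine (sqint (fun z => f z - \sum_(i <- s) c i * e i z)) =
  fine (sqint f) - \sum_(i <- s) nsq (cip f (e i)) +
  \sum_(i <- s) nsq (c i - cip f (e i)).
Proof.
move=> us Lf; set p := fun z => \sum_(i <- s) c i * e i z.
have Lce i : L2c (fun z => c i * e i z) by exact: L2cZ.
have Lp : L2c p by exact: L2c_sum.
have LNp : L2c (fun z => (-1) * p z) by exact: L2cZ.
have pe j : j \in s -> cip p (e j) = c j.
  move=> js; rewrite cip_suml // (bigD1_seq j) //= cipZl // orth eqxx mulr1.
  rewrite big1 ?addr0 // => i ij.
  by rewrite cipZl // orth (negbTE ij) mulr0.
have cp h : L2c h -> cip p h = \sum_(i <- s) c i * Num.conj (cip h (e i)).
  move=> Lh; rewrite cip_suml //; apply: eq_bigr => i _.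
  by rewrite cipZl // [cip (e i) h]cipC.
have fp : cip f p = \sum_(i <- s) Num.conj (c i) * cip f (e i).
  rewrite cipC // cp // rmorph_sum /=; apply: eq_bigr => i _.
  by rewrite rmorphM /= conjCK.
(* In [C] squared norms become inner products by [cip_self], and the identity is sesquilinear
   algebra. *)
apply: complexI; rewrite rmorphD rmorphB /= -!cip_self //; last first.
  exact: L2cB.
have Lq : L2c (fun z => f z - p z) by exact: L2cB.
have ql h : L2c h -> cip (fun z => f z - p z) h = cip f h - cip p h.
  move=> Lh; have -> : (fun z => f z - p z) = (fun z => f z + (-1) * p z).
    by apply/funext => z; rewrite mulN1r.
  by rewrite cipDl // cipZl // mulN1r.
have qr h : L2c h -> cip h (fun z => f z - p z) = cip h f - cip h p.
  by move=> Lh; rewrite cipC // ql // rmorphB /= -!cipC.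
rewrite ql // !qr // fp !cp // !rmorph_sum /=.
have -> : \sum_(i <- s) c i * Num.conj (cip p (e i)) =
          \sum_(i <- s) c i * Num.conj (c i).
  by rewrite !big_seq; apply: eq_bigr => i /pe ->.
set X := cip f f.
transitivity (X - \sum_(i <- s) (Num.conj (c i) * cip f (e i)
  + c i * Num.conj (cip f (e i)) - c i * Num.conj (c i))).
  rewrite !big_split /= sumrN; ring.
rewrite -addrA; congr (X + _); rewrite -!sumrN -big_split /=; apply: eq_bigr => i _.
by rewrite -!conjM_nsq rmorphB /=; ring.
Qed.

Lemma bessel_orthonormal (s : seq I) f : uniq s -> L2c f ->
  \sum_(i <- s) nsq (cip f (e i)) <= fine (sqint f).
Proof.
move=> us Lf.
have := pythagoras_orthonormal (fun i => cip f (e i)) us Lf.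
rewrite [X in _ = _ + X]big1 => [|i _]; last by rewrite subrr nsq0.
by rewrite addr0 -subr_ge0 => <-; rewrite fine_ge0 // sqint_ge0.
Qed.

Lemma orthonormal_approx (s : seq I) (c : I -> C) f : uniq s -> L2c f ->
  fine (sqint f) <= \sum_(i <- s) nsq (cip f (e i)) +
    fine (sqint (fun z => f z - \sum_(i <- s) c i * e i z)).
Proof.
move=> us Lf; rewrite pythagoras_orthonormal //.
set T := \sum_(i <- s) nsq (c i - _).
have : 0 <= T by rewrite sumr_ge0 // => i _; exact: nsq_ge0.
lra.
Qed.

End orthonormal.
End complex_L2.

(** * Parseval identity *)

Section fourier_system.
Variable R : realType.
Local Notation mu := (@circle_measure R).
Local Notation C := (R[i]).
Local Notation leb := (@lebesgue_measure R).
Local Notation restr := (mrestr leb (measurable_itv `[(0 : R), 1[)).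

Lemma integrable_of_bounded d (T : measurableType d) (nu : {measure set T -> \bar R})
    (f : T -> R) (B : R) : (nu setT < +oo)%E -> measurable_fun setT f ->
  (forall x, `|f x| <= B) -> nu.-integrable setT (EFin \o f).
Proof.
move=> nufin mf fB; apply: measurable_bounded_integrable => //.
exists B; split; first exact: num_real.
by move=> K BK x _ /=; exact: le_trans (fB x) (ltW BK).
Qed.

Lemma restrT : restr setT = 1%E.
Proof.
rewrite /mrestr setTI lebesgue_measure_itv /= lte_fin ltr01.
by rewrite oppr0 adde0.
Qed.

Lemma circle_measureT : mu setT = 1%E.
Proof. by rewrite -restrT. Qed.

Lemma circle_measure_lty : (mu setT < +oo)%E.
Proof. by rewrite circle_measureT ltry. Qed.

Let measurable_exp :
  measurable_fun (setT : set (measurableTypeR R)) (@circle_exp R).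
Proof. exact: measurable_circle_exp. Qed.

Lemma integral_circle (u : circle R -> R) (B : R) : measurable_fun setT u ->
  (forall z, `|u z| <= B) ->
  (\int[mu]_z (u z)%:E = \int[leb]_(t in `[0%R, 1%R]) (u (circle_exp t))%:E)%E.
Proof.
move=> mu_ uB.
have mue : measurable_fun (setT : set (measurableTypeR R)) (u \o @circle_exp R).
  exact: measurableT_comp mu_ measurable_exp.
have iue : (restr).-integrable setT (EFin \o (u \o @circle_exp R)).
  apply: (@integrable_of_bounded _ _ _ _ B) => //=.
  by rewrite restrT ltry.
have mE : measurable_fun setT (EFin \o u) by exact/measurable_EFinP.
transitivity (\int[restr]_t ((EFin \o u) \o (@circle_exp R)) t)%E.
  have := integral_pushforward measurable_exp (D := setT) mE iue measurableT.
  by move=> <-; apply: eq_measure_integral.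
(* The closed interval is the form wanted by the fundamental theorem of calculus; the measure itself
   lives on [0, 1[, and the endpoint is negligible. *)
rewrite -integral_itv_bndo_bndc; last first.
  by apply/measurable_EFinP; exact: measurable_funTS.
rewrite (@negligible_integral _ _ _ _ _
  (~` (`[0 : R, 1[%classic : set (measurableTypeR R)))) //; last 2 first.
- exact: measurableC.
- by rewrite /= /mrestr setICl measure0.
rewrite setDE setTI setCK; apply: eq_measure_integral => A mA AI.
by rewrite /= /mrestr setIidl.
Qed.

Lemma integral_cos_period (w : R) : w != 0 -> sin w = 0 ->
  (\int[leb]_(t in `[0%R, 1%R]) (cos (w * t))%:E = 0)%E.
Proof.
move=> w0 sw.
have dF (x : R) : is_derive x (1 : R) (fun t => w^-1 * sin (w * t)) (cos (w * x)).
  by apply: is_derive_eq; rewrite /GRing.scale /= mulr1; field.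
have cF (x : R) : {for x, continuous (fun t => w^-1 * sin (w * t))}.
  by apply/differentiable_continuous/derivable1_diffP; have [] := dF x.
rewrite (@continuous_FTC2 _ _ (fun t => w^-1 * sin (w * t))) //.
- by rewrite !mulr1 sw !mulr0 sin0 mulr0 subee.
- apply: continuous_subspaceT => x.
  apply: (@continuous_comp _ _ _ (fun t => w * t)) => //; last exact: continuous_cos.
  by apply: cvgM; [exact: cvg_cst | exact: cvg_id].
- split=> [x _||]; first by have [] := dF x.
  + exact/cvg_at_right_filter/cF.
  + exact/cvg_at_left_filter/cF.
- by move=> x _; rewrite derive1E; have [_ ->] := dF x.
Qed.

Lemma integral_sin_period (w : R) : w != 0 -> cos w = 1 ->
  (\int[leb]_(t in `[0%R, 1%R]) (sin (w * t))%:E = 0)%E.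
Proof.
move=> w0 cw.
have dF (x : R) : is_derive x (1 : R) (fun t => - w^-1 * cos (w * t)) (sin (w * x)).
  by apply: is_derive_eq; rewrite /GRing.scale /= mulr1; field.
have cF (x : R) : {for x, continuous (fun t => - w^-1 * cos (w * t))}.
  by apply/differentiable_continuous/derivable1_diffP; have [] := dF x.
rewrite (@continuous_FTC2 _ _ (fun t => - w^-1 * cos (w * t))) //.
- by rewrite !mulr1 cw !mulr0 cos0 mulr1 subee.
- apply: continuous_subspaceT => x.
  apply: (@continuous_comp _ _ _ (fun t => w * t)) => //; last exact: continuous_sin.
  by apply: cvgM; [exact: cvg_cst | exact: cvg_id].
- split=> [x _||]; first by have [] := dF x.
  + exact/cvg_at_right_filter/cF.
  + exact/cvg_at_left_filter/cF.
- by move=> x _; rewrite derive1E; have [_ ->] := dF x.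
Qed.

Lemma circle_nsq (z : circle R) : nsq (sval z) = 1.
Proof.
case: z => -[a b] /= h; rewrite nsqE.
move: h; rewrite normc_def => /eqP [h]; rewrite /= h expr1n //.
Qed.

Lemma circle_neq0 (z : circle R) : sval z != 0.
Proof.
apply/eqP => z0; have := circle_nsq z; rewrite z0 nsq0 => /eqP.
by rewrite eq_sym oner_eq0.
Qed.

Lemma circle_conj (z : circle R) : Num.conj (sval z) = (sval z)^-1.
Proof.
apply: (mulfI (circle_neq0 z)).
by rewrite mulfV ?circle_neq0 // conjM_nsq circle_nsq.
Qed.

Definition expi (n : int) (z : circle R) : C := sval z ^ n.

Lemma expiD m n z : expi (m + n) z = expi m z * expi n z.
Proof. by rewrite /expi expfzDr // circle_neq0. Qed.

Lemma expi_conj n z : Num.conj (expi n z) = expi (- n) z.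
Proof. by rewrite /expi rmorphXz /= ?circle_conj ?exprz_inv // unitfE circle_neq0. Qed.

Lemma expi_nsq n z : nsq (expi n z) = 1.
Proof.
apply: (complexI (R := R)).
rewrite -conjM_nsq expi_conj -expiD subrr /expi expr0z //.
Qed.

Lemma cmeasurable_coord : cmeasurable (fun z : circle R => sval z).
Proof.
have mc : measurable_fun setT (@circle_coord R : circle R -> R * R).
  by move=> _ B mB; rewrite setTI; exists B => //; rewrite setTI.
have /measurable_fun_pairP [m1 m2] := mc.
by split.
Qed.

Lemma cmeasurable_expi n : cmeasurable (expi n).
Proof.
have mX k : cmeasurable (fun z : circle R => sval z ^+ k).
  elim: k => [|k IH].
    by under eq_fun do rewrite expr0; exact: cmeasurable_cst.
  by under eq_fun do rewrite exprS; exact: cmeasurableM cmeasurable_coord IH.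
case: n => k; first exact: mX.
rewrite (_ : expi _ = fun z : circle R => Num.conj (sval z ^+ k.+1)).
  exact: cmeasurable_conj.
apply/funext => z; rewrite (_ : sval z ^+ k.+1 = expi k.+1 z) // expi_conj.
by rewrite NegzE.
Qed.

Lemma L2c_expi n : L2c (expi n).
Proof.
apply: (@L2c_dominated _ _ (fun=> 1)).
- exact: cmeasurable_expi.
- apply: (@integrable_of_bounded _ _ _ _ 1) => //; first exact: circle_measure_lty.
  by move=> x; rewrite normr1.
- by move=> z; rewrite expi_nsq.
Qed.

Lemma expi_exp (k : nat) t : expi k (circle_exp t) =
  cos (2 * pi * k%:R * t) +i* sin (2 * pi * k%:R * t).
Proof.
elim: k => [|k IH]; first by rewrite /expi expr0z !mulr0 !mul0r cos0 sin0.
rewrite (_ : expi k.+1 _ = sval (circle_exp t) * expi k (circle_exp t)).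
  rewrite IH /=.
  have -> : 2 * pi * k.+1%:R * t = 2 * pi * t + 2 * pi * k%:R * t.
    rewrite -[k.+1]addn1 natrD; ring.
  rewrite cosD sinD; congr (_ +i* _); ring.
by rewrite /expi -exprSz.
Qed.

Lemma Re_le1 (w : C) : nsq w = 1 -> `|complex.Re w| <= 1.
Proof.
rewrite /nsq => h; rewrite -(@ler_pXn2r _ 2) ?nnegrE // expr1n real_normK ?num_real //.
by have := sqr_ge0 (complex.Im w); lra.
Qed.

Lemma Im_le1 (w : C) : nsq w = 1 -> `|complex.Im w| <= 1.
Proof.
rewrite /nsq => h; rewrite -(@ler_pXn2r _ 2) ?nnegrE // expr1n real_normK ?num_real //.
by have := sqr_ge0 (complex.Re w); lra.
Qed.

Lemma cintegral_expi_nat (k : nat) : (0 < k)%N -> cintegral (expi k) = 0.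
Proof.
move=> k0.
have w0 : 2 * pi * k%:R != 0 :> R.
  by rewrite !mulf_neq0 // ?gt_eqF ?pi_gt0 ?ltr0n.
(* The values of cos and sin at 2 pi k are read off from [circle_exp 1 = circle_exp 0]. *)
have e1 : expi k (circle_exp (1 : R)) = 1.
  have : circle_exp (1 : R) = circle_exp (0 : R).
    by apply/val_inj; rewrite /= mulr1 mulr0 mulr_natl cos2pi sin2pi cos0 sin0.
  by move=> ->; rewrite expi_exp mulr0 cos0 sin0.
have [cw sw] : cos (2 * pi * k%:R : R) = 1 /\ sin (2 * pi * k%:R : R) = 0.
  by move: e1; rewrite expi_exp mulr1 => -[].
have [m1 m2] := cmeasurable_expi k.
rewrite /cintegral /Rintegral (@integral_circle _ 1) //; last first.
  by move=> z; exact/Re_le1/expi_nsq.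
rewrite (@integral_circle _ 1) //; last first.
  by move=> z; exact/Im_le1/expi_nsq.
under eq_integral do rewrite expi_exp /=.
rewrite integral_cos_period //.
under eq_integral do rewrite expi_exp /=.
by rewrite integral_sin_period.
Qed.

Lemma cintegral1 : cintegral (fun _ : circle R => 1) = 1.
Proof.
rewrite /cintegral /= /Rintegral integral0 integral_cst //.
by rewrite (_ : (_ * _)%E = 1%E) // mul1e; exact: circle_measureT.
Qed.

Lemma expi_orthonormal m n : cip (expi m) (expi n) = (m == n)%:R.
Proof.
rewrite /cip; under eq_fun do rewrite expi_conj -expiD.
have [->|mn] := eqVneq m n.
  under eq_fun do rewrite subrr /expi expr0z.
  exact: cintegral1.
have : m - n != 0 by rewrite subr_eq0.
case: (m - n) => k kn.
  by rewrite cintegral_expi_nat // lt0n.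
rewrite NegzE; under eq_fun do rewrite -expi_conj.
rewrite cintegral_conj ?cintegral_expi_nat ?rmorph0 //.
(* Integrability of [expi k.+1] follows by seeing it as its product with the conjugate of [expi 0],
   which is 1. *)
have := cintegrable_mulconj (L2c_expi k.+1) (L2c_expi 0).
by under eq_fun do rewrite expi_conj -expiD subr0.
Qed.

End fourier_system.

(** * The algebra of bounded limits of trigonometric polynomials *)

Section trig_density.
Variable R : realType.
Local Notation mu := (@circle_measure R).
Local Notation C := (R[i]).
Implicit Types f g h : circle R -> C.

(** Plays the part of the triangle inequality; its factors 2 are the reason for the errors [e / 4]
    requested later. *)
Lemma sqintD_le f g : cmeasurable f -> cmeasurable g ->
  (sqint (fun z => (f z + g z)%R) <= 2%:E * sqint f + 2%:E * sqint g)%E.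
Proof.
move=> mf mg.
have m2 h : cmeasurable h -> measurable_fun setT (fun z => (2 * nsq (h z))%:E).
  move=> mh; apply/measurable_EFinP.
  by apply: measurable_funM => //; exact: measurable_nsq.
have e2 h : cmeasurable h -> (2%:E * sqint h = \int[mu]_z (2 * nsq (h z))%:E)%E.
  move=> mh; under eq_integral do rewrite EFinM.
  rewrite ge0_integralZl //.
  - by apply/measurable_EFinP; exact: measurable_nsq.
  - by move=> z _; rewrite lee_fin nsq_ge0.
rewrite !e2 // -ge0_integralD //; first last.
- exact: m2.
- by move=> z _; rewrite lee_fin mulr_ge0 // nsq_ge0.
- exact: m2.
- by move=> z _; rewrite lee_fin mulr_ge0 // nsq_ge0.
apply: ge0_le_integral => //.
- by move=> z _; rewrite lee_fin nsq_ge0.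
- by apply/measurable_EFinP/measurable_nsq/cmeasurableD.
- by apply: emeasurable_funD; exact: m2.
- by move=> z _; rewrite -EFinD lee_fin nsqD_le.
Qed.

Lemma sqintM_le (B : R) f g : cmeasurable f -> cmeasurable g -> 0 <= B ->
  (forall z, nsq (f z) <= B) ->
  (sqint (fun z => (f z * g z)%R) <= B%:E * sqint g)%E.
Proof.
move=> mf mg B0 fB.
have mg2 : measurable_fun setT (fun z => (nsq (g z))%:E).
  by apply/measurable_EFinP; exact: measurable_nsq.
rewrite /sqint -ge0_integralZl //.
- apply: ge0_le_integral => //.
  + by move=> z _; rewrite lee_fin nsq_ge0.
  + by apply/measurable_EFinP/measurable_nsq/cmeasurableM.
  + exact: measurable_funeM.
  + by move=> z _; rewrite -EFinM lee_fin nsqM ler_wpM2r // nsq_ge0.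
- by move=> z _; rewrite lee_fin nsq_ge0.
Qed.

Lemma sqint_cvg0 (h : nat -> circle R -> C) (G : circle R -> R) :
  (forall n, cmeasurable (h n)) -> mu.-integrable setT (EFin \o G) ->
  (forall n z, nsq (h n z) <= G z) ->
  (forall z, nsq (h n z) @[n --> \oo] --> 0) ->
  forall e : R, 0 < e -> exists n, (sqint (h n) <= e%:E)%E.
Proof.
move=> mh iG hG h0 e e0.
have [|||||_ _] := @dominated_convergence _ _ _ mu _ measurableT
  (fun n z => (nsq (h n z))%:E) (fun=> 0%E) (EFin \o G) => //.
- by move=> n; apply/measurable_EFinP; exact: measurable_nsq.
- by apply: aeW => z _; apply: cvg_EFin; [exact: nearW | exact: h0].
- apply: aeW => z n _.
  by rewrite /= lee_fin ger0_norm ?nsq_ge0.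
rewrite integral0 => /fine_cvgP [fin cv].
have : \forall n \near \oo, fine (\int[mu]_x (nsq (h n x))%:E)%E <= e.
  have /cvgrPdist_le /(_ _ e0) := cv.
  apply: filterS => n; rewrite sub0r normrN; apply: le_trans; exact: ler_norm.
move=> le_e; have [n [/= fn en]] := filter_ex (filterI fin le_e).
by exists n; rewrite /sqint -(fineK fn) lee_fin.
Qed.

(** A trigonometric polynomial as an ordinary polynomial over the common denominator z^N, so that
    sums and products reduce to polynomial arithmetic. *)
Definition tpoly (P : {poly C}) (N : nat) (z : circle R) : C :=
  P.[sval z] * expi (- N%:Z) z.

(** The frequencies are i - N for i below [size P]; there [i + N] is nonnegative, so [absz] recovers
    the index of the coefficient. *)
Lemma tpolyE P N z : tpoly P N z =
  \sum_(i <- [seq i%:Z - N%:Z | i <- iota 0 (size P)]) P`_(absz (i + N%:Z)) * expi i z.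
Proof.
rewrite /tpoly horner_coef mulr_suml big_map.
have -> : iota 0 (size P) = index_iota 0 (size P) by rewrite /index_iota subn0.
rewrite big_mkord; apply: eq_bigr => i _.
by rewrite subrK expiD mulrA.
Qed.

(** The bound concerns [f] alone. The approximating polynomials need not be uniformly bounded, and
    each may have its own degree. *)
Definition trig_approx f := [/\ cmeasurable f,
  exists B, forall z, nsq (f z) <= B &
  forall e : R, 0 < e -> exists P N,
    (sqint (fun z => (f z - tpoly P N z)%R) <= e%:E)%E].

Lemma cmeasurable_tpoly P N : cmeasurable (tpoly P N).
Proof.
rewrite (funext (tpolyE P N)); apply: cmeasurable_sum => i.
by apply: cmeasurableM; [exact: cmeasurable_cst | exact: cmeasurable_expi].
Qed.

Lemma sqint0 : sqint (fun _ : circle R => 0) = 0%E.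
Proof. by rewrite /sqint nsq0 integral0. Qed.

Lemma trig_approx_tpoly P N : trig_approx (tpoly P N).
Proof.
split; first exact: cmeasurable_tpoly.
- eexists => z; rewrite tpolyE; apply: le_trans (nsq_sum_le _ _) _.
  by under eq_bigr do rewrite nsqM expi_nsq mulr1; exact: lexx.
- move=> e e0; exists P, N; under eq_fun do rewrite subrr.
  by rewrite sqint0 lee_fin ltW.
Qed.

Lemma nsq_bound_ge0 f B : (forall z, nsq (f z) <= B) -> 0 <= B.
Proof. by move=> fB; exact: le_trans (nsq_ge0 _) (fB point). Qed.

Lemma trig_approxD f g : trig_approx f -> trig_approx g ->
  trig_approx (fun z => f z + g z).
Proof.
move=> [mf [Bf fB] af] [mg [Bg gB] ag]; split; first exact: cmeasurableD.
  exists (2 * Bf + 2 * Bg) => z; apply: le_trans (nsqD_le _ _) _.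
  by rewrite lerD // ler_pM2l.
move=> e e0.
have [|P [N PN]] := af (e / 4); first by rewrite divr_gt0.
have [|Q [K QK]] := ag (e / 4); first by rewrite divr_gt0.
(* Both fractions are brought to the common denominator z^(N + K). *)
exists (P * 'X^K + Q * 'X^N), (N + K)%N.
have -> : (fun z => f z + g z - tpoly (P * 'X^K + Q * 'X^N) (N + K) z) =
    (fun z => (f z - tpoly P N z) + (g z - tpoly Q K z)).
  apply/funext => z.
  suff -> : tpoly (P * 'X^K + Q * 'X^N) (N + K) z = tpoly P N z + tpoly Q K z.
    by rewrite opprD addrACA.
  have X n : (sval z) ^+ n = expi n z by [].
  rewrite /tpoly !hornerE !X mulrDl -!mulrA -!expiD PoszD.
  by congr (_ * expi _ _ + _ * expi _ _); ring.
apply: le_trans (sqintD_le _ _) _.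
- exact: cmeasurableB (cmeasurable_tpoly _ _).
- exact: cmeasurableB (cmeasurable_tpoly _ _).
rewrite (_ : e%:E = 2%:E * (e / 4)%:E + 2%:E * (e / 4)%:E)%E.
  by rewrite leeD // lee_pmul2l.
by rewrite -!EFinM -EFinD; congr EFin; field.
Qed.

Lemma trig_approx_lim f B : cmeasurable f -> (forall z, nsq (f z) <= B) ->
  (forall e : R, 0 < e -> exists g, trig_approx g /\
     (sqint (fun z => (f z - g z)%R) <= e%:E)%E) -> trig_approx f.
Proof.
move=> mf fB lf; split=> //; first by exists B.
move=> e e0.
have [|g [[mg _ ag] fg]] := lf (e / 4); first by rewrite divr_gt0.
have [|P [N PN]] := ag (e / 4); first by rewrite divr_gt0.
exists P, N.
have -> : (fun z => f z - tpoly P N z) =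
    (fun z => (f z - g z) + (g z - tpoly P N z)).
  by apply/funext => z; rewrite addrA subrK.
apply: le_trans (sqintD_le _ _) _.
- exact: cmeasurableB.
- exact: cmeasurableB (cmeasurable_tpoly _ _).
rewrite (_ : e%:E = 2%:E * (e / 4)%:E + 2%:E * (e / 4)%:E)%E.
  by rewrite leeD // lee_pmul2l.
by rewrite -!EFinM -EFinD; congr EFin; field.
Qed.

Lemma tpolyM P N Q K z : tpoly (P * Q) (N + K) z = tpoly P N z * tpoly Q K z.
Proof. by rewrite /tpoly hornerM PoszD opprD expiD mulrACA. Qed.

(** Dividing the error by B + 1 instead of B covers a bound B equal to 0. *)
Lemma mul_div_succ_le (B e : R) : 0 <= B -> 0 <= e -> B * (e / (B + 1)) <= e.
Proof.
move=> B0 e0; rewrite mulrCA ler_piMr // ler_pdivrMr ?ltr_wpDl // mul1r.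
by rewrite lerDl.
Qed.

(* Multiplying first by a trigonometric polynomial, which is bounded, reduces
   the product of two bounded approximable functions to two limits. *)
Lemma trig_approxM f g : trig_approx f -> trig_approx g ->
  trig_approx (fun z => f z * g z).
Proof.
move=> tf tg; have [mf [Bf fB] af] := tf; have [mg [Bg gB] ag] := tg.
have Bf0 := nsq_bound_ge0 fB; have Bg0 := nsq_bound_ge0 gB.
have tP P N : trig_approx (fun z => tpoly P N z * g z).
  have [mp [Bp pB] _] := trig_approx_tpoly P N.
  have Bp0 := nsq_bound_ge0 pB.
  apply: (@trig_approx_lim _ (Bp * Bg)).
  - exact: cmeasurableM.
  - by move=> z; rewrite nsqM ler_pM ?nsq_ge0.
  move=> e e0.
  have [|Q [K QK]] := ag (e / (Bp + 1)); first by rewrite divr_gt0 // ltr_wpDl.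
  exists (tpoly (P * Q) (N + K)); split; first exact: trig_approx_tpoly.
  under eq_fun do rewrite tpolyM -mulrBr.
  apply: le_trans (sqintM_le mp _ Bp0 pB) _.
    exact: cmeasurableB (cmeasurable_tpoly _ _).
  apply: (le_trans (lee_wpmul2l _ QK)); first by rewrite lee_fin.
  by rewrite -EFinM lee_fin mul_div_succ_le // ltW.
apply: (@trig_approx_lim _ (Bf * Bg)).
- exact: cmeasurableM.
- by move=> z; rewrite nsqM ler_pM ?nsq_ge0.
move=> e e0.
have [|P [N PN]] := af (e / (Bg + 1)); first by rewrite divr_gt0 // ltr_wpDl.
exists (fun z => tpoly P N z * g z); split=> //.
under eq_fun do rewrite -mulrBl mulrC.
apply: le_trans (sqintM_le mg _ Bg0 gB) _.
  exact: cmeasurableB (cmeasurable_tpoly _ _).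
apply: (le_trans (lee_wpmul2l _ PN)); first by rewrite lee_fin.
by rewrite -EFinM lee_fin mul_div_succ_le // ltW.
Qed.

Lemma trig_approx_cst (c : C) : trig_approx (fun=> c).
Proof.
have := trig_approx_tpoly c%:P 0; congr trig_approx; apply/funext => z.
by rewrite /tpoly hornerC /expi oppr0 expr0z mulr1.
Qed.

Definition rtrig_approx (u : circle R -> R) := trig_approx (fun z => (u z)%:C).

Lemma rtrig_approxD u v : rtrig_approx u -> rtrig_approx v ->
  rtrig_approx (fun z => u z + v z).
Proof.
move=> au av; rewrite /rtrig_approx; under eq_fun do rewrite rmorphD.
exact: trig_approxD.
Qed.

Lemma rtrig_approxM u v : rtrig_approx u -> rtrig_approx v ->
  rtrig_approx (fun z => u z * v z).
Proof.
move=> au av; rewrite /rtrig_approx; under eq_fun do rewrite rmorphM.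
exact: trig_approxM.
Qed.

Lemma rtrig_approx_cst c : rtrig_approx (fun=> c).
Proof. exact: trig_approx_cst. Qed.

Lemma rtrig_approxB u v : rtrig_approx u -> rtrig_approx v ->
  rtrig_approx (fun z => u z - v z).
Proof.
move=> au av; apply: rtrig_approxD => //.
by under eq_fun do rewrite -mulN1r; exact: rtrig_approxM (rtrig_approx_cst _) av.
Qed.

Lemma rtrig_approx_sum (I : Type) (s : seq I) (F : I -> circle R -> R) :
  (forall i, rtrig_approx (F i)) ->
  rtrig_approx (fun z => \sum_(i <- s) F i z).
Proof.
move=> aF; elim: s => [|i s IH].
  by under eq_fun do rewrite big_nil; exact: rtrig_approx_cst.
by under eq_fun do rewrite big_cons; exact: rtrig_approxD.
Qed.

Lemma rtrig_approx_cvg (u_ : nat -> circle R -> R) (u : circle R -> R) B :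
  (forall n, rtrig_approx (u_ n)) -> (forall n z, `|u_ n z| <= B) ->
  (forall z, u_ n z @[n --> \oo] --> u z) -> rtrig_approx u.
Proof.
move=> au uB cu.
have mu_ : measurable_fun setT u.
  by apply: measurable_fun_cvg (fun z _ => cu z) => n; have [[]] := au n.
have uB' z : `|u z| <= B.
  apply: (@cvgr_to_le _ \oo _ _ (fun n => `|u_ n z|)).
    by apply: cvg_norm; exact: cu.
  by apply: nearW => n.
have sq_le (x y : R) : `|x| <= y -> x ^+ 2 <= y ^+ 2.
  move=> xy; rewrite -real_normK ?num_real // ler_pXn2r ?nnegrE //.
  exact: le_trans (normr_ge0 _) xy.
apply: (@trig_approx_lim _ (B ^+ 2)).
- exact: cmeasurable_real.
- by move=> z; rewrite nsq_real; exact: sq_le.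
move=> e e0.
have [||||n hn] := @sqint_cvg0 (fun n z => (u z)%:C - (u_ n z)%:C)
   (fun=> (B + B) ^+ 2) _ _ _ _ e e0 => //.
- by move=> n; apply: cmeasurableB; [exact: cmeasurable_real | have [] := au n].
- apply: (@integrable_of_bounded _ _ _ _ _ ((B + B) ^+ 2)) => //.
    exact: circle_measure_lty.
  by move=> x; rewrite ger0_norm // sqr_ge0.
- move=> n z; rewrite -rmorphB nsq_real; apply: sq_le.
  by apply: le_trans (ler_normB _ _) _; rewrite lerD.
- move=> z; under eq_fun do rewrite -rmorphB nsq_real expr2.
  have c0 : u z - u_ n z @[n --> \oo] --> 0.
    rewrite -(subrr (u z)); apply: cvgB => //; exact: cvg_cst.
  by have := cvgM c0 c0; rewrite mulr0; exact.
- by exists (fun z => (u_ n z)%:C); split; [exact: au | exact: hn].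
Qed.

End trig_density.

(** * Indicators, bounded functions and density in L2 *)

Section trig_density_sets.
Import HBSimple HBNNSimple.
Variable R : realType.
Local Notation mu := (@circle_measure R).
Local Notation C := (R[i]).

(* The iteration [s' = s + (u^2 - s^2) / 2] converges to [|u|] on [|u| <= 1]. *)
Lemma rtrig_approx_norm (u : circle R -> R) : rtrig_approx u ->
  (forall z, `|u z| <= 1) -> rtrig_approx (fun z => `|u z|).
Proof.
move=> au u1.
pose s := fix s n (z : circle R) : R :=
  if n is n'.+1 then s n' z + 2^-1 * (u z * u z - s n' z * s n' z) else 0.
have sb n z : 0 <= s n z <= `|u z| /\
    `|u z| - s n z <= `|u z| * (1 - `|u z| / 2) ^+ n.
  elim: n => [|n [/andP[s0 su] IH]] /=.
    by rewrite lexx normr_ge0 expr0 mulr1 subr0.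
  have uu : u z * u z = `|u z| * `|u z| by rewrite -normrM ger0_norm // -expr2 sqr_ge0.
  have h1 := u1 z; have h0 := normr_ge0 (u z).
  rewrite uu; set a := `|u z| in s0 su IH h1 h0 *; set b := s n z in s0 su IH *.
  have [d0 d1] : 0 <= a - b /\ a - b <= 1 by split; lra.
  split; first by apply/andP; split; nra.
  rewrite exprSr mulrA.
  (* Since a^2 - b^2 = (a - b)(a + b), one step multiplies the error a - b by 1 - (a + b)/2, which
     is at most 1 - a/2. *)
  have e : a - (b + 2^-1 * (a * a - b * b)) = (a - b) * (1 - (a + b) / 2) by field.
  rewrite e; apply: (@le_trans _ _ ((a - b) * (1 - a / 2))).
    by rewrite ler_wpM2l //; lra.
  by rewrite ler_wpM2r //; lra.
apply: (@rtrig_approx_cvg _ s _ 1).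
- elim=> [|n IH]; first exact: rtrig_approx_cst.
  apply: rtrig_approxD => //; apply: rtrig_approxM; first exact: rtrig_approx_cst.
  by apply: rtrig_approxB; exact: rtrig_approxM.
- move=> n z; have [/andP[s0 su] _] := sb n z.
  by rewrite ger0_norm // (le_trans su).
(* Where [u] vanishes the geometric ratio is 1, so this case is treated apart; there the iterates
   are all 0. *)
- move=> z; have [u0|un0] := eqVneq (u z) 0.
    apply: cvg_near_cst; apply: nearW => n.
    have [/andP[s0 su] _] := sb n z; apply/eqP; rewrite eq_le su /=.
    by rewrite u0 normr0.
  have up : 0 < `|u z| by rewrite normr_gt0.
  have h1 := u1 z.
  have c0 : `|u z| - `|u z| * (1 - `|u z| / 2) ^+ n @[n --> \oo] --> `|u z|.
    rewrite -[X in _ --> X]subr0; apply: cvgB; first exact: cvg_cst.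
    rewrite -(mulr0 `|u z|); apply: cvgM; first exact: cvg_cst.
    by apply: cvg_expr; rewrite ger0_norm; lra.
  apply: (squeeze_cvgr _ c0 (cvg_cst _)); apply: nearW => n.
  have [/andP[s0 su] h] := sb n z; rewrite su andbT; lra.
Qed.

(** The functions 1 - (1 - u)^n tend to 1 where 0 < u <= 1 and stay at 0, for n > 0 as for n = 0,
    where u = 0. *)
Lemma rtrig_approx_pos_set (u : circle R -> R) : rtrig_approx u ->
  (forall z, 0 <= u z <= 1) -> rtrig_approx (\1_[set z | 0 < u z]).
Proof.
move=> au u1.
apply: (@rtrig_approx_cvg _ (fun n z => 1 - (1 - u z) ^+ n) _ 1).
- move=> n; apply: rtrig_approxB; first exact: rtrig_approx_cst.
  elim: n => [|n IH]; first exact: rtrig_approx_cst.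
  under eq_fun do rewrite exprS; apply: rtrig_approxM => //.
  by apply: rtrig_approxB => //; exact: rtrig_approx_cst.
- move=> n z; have /andP[h0 h1] := u1 z.
  have p0 : 0 <= (1 - u z) ^+ n by rewrite exprn_ge0 // subr_ge0.
  have p1 : (1 - u z) ^+ n <= 1 by rewrite exprn_ile1 //; lra.
  by rewrite ger0_norm; lra.
- move=> z; have /andP[h0 h1] := u1 z; rewrite indicE.
  have [up|un] := boolP (0 < u z).
    rewrite mem_set //= -[X in _ --> X]subr0; apply: cvgB; first exact: cvg_cst.
    by apply: cvg_expr; rewrite ger0_norm; lra.
  have u0 : u z = 0 by apply/eqP; rewrite eq_le h0 leNgt un.
  rewrite memNset; last exact/negP.
  by apply: cvg_near_cst; apply: nearW => n; rewrite u0 subr0 expr1n subrr.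
Qed.

Lemma rtrig_approx_gt (u : circle R -> R) a : rtrig_approx u ->
  (forall z, `|u z| <= 1) -> rtrig_approx (\1_[set z | a < u z]).
Proof.
move=> au u1.
(* As |u - a| <= 1 + |a|, this factor brings [u - a] into [-1, 1], where the absolute value is
   available. The function [w] below is the positive part of the result. *)
pose c := (1 + `|a|)^-1.
have cp : 0 < 1 + `|a| by rewrite ltr_pwDl.
have c0 : 0 < c by rewrite invr_gt0.
pose v z := c * (u z - a).
have av : rtrig_approx v.
  by apply: rtrig_approxM; last apply: rtrig_approxB => //; exact: rtrig_approx_cst.
have v1 z : `|v z| <= 1.
  rewrite /v normrM (ger0_norm (ltW c0)) mulrC ler_pdivrMr // mul1r.
  by apply: le_trans (ler_normB _ _) _; rewrite lerD2r.
pose w z := 2^-1 * (v z + `|v z|).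
have -> : [set z | a < u z] = [set z | 0 < w z].
  apply/seteqP; split => z /=.
    move=> auz; have vp : 0 < v z by rewrite mulr_gt0 // subr_gt0.
    by rewrite /w ger0_norm ?ltW // mulr_gt0 // addr_gt0.
  move=> wp; rewrite ltNge; apply/negP => uza; move: wp.
  have vn : v z <= 0 by rewrite mulr_ge0_le0 ?(ltW c0) // subr_le0.
  by rewrite /w ler0_norm // subrr mulr0 ltxx.
apply: rtrig_approx_pos_set.
- apply: rtrig_approxM; first exact: rtrig_approx_cst.
  by apply: rtrig_approxD => //; exact: rtrig_approx_norm.
- move=> z; rewrite /w; have := v1 z; have := ler_norm (v z).
  have := ler_norm (- v z); rewrite normrN => h1 h2 h3.
  by apply/andP; split; lra.
Qed.

(** Complements correspond to 1 - \1_A. A countable union is the complement of an intersection of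
    complements, whose indicator is the pointwise limit of finite products. *)
Lemma sigma_algebra_rtrig_approx :
  sigma_algebra setT [set A : set (circle R) | rtrig_approx (\1_A)].
Proof.
have aC (A : set (circle R)) : rtrig_approx (\1_A) -> rtrig_approx (\1_(~` A)).
  move=> aA; have -> : \1_(~` A) = (fun z => 1 - \1_A z) :> (circle R -> R).
    by rewrite indicC; apply/funext => z; rewrite indicE; case: (z \in A);
      rewrite ?subrr ?subr0.
  by apply: rtrig_approxB => //; exact: rtrig_approx_cst.
split=> /=.
- have -> : \1_set0 = (fun=> 0) :> (circle R -> R).
    by apply/funext => z; rewrite indic0.
  exact: rtrig_approx_cst.
- by move=> A aA; rewrite setTD; exact: aC.
- move=> A aA; rewrite -[X in \1_X]setCK; apply: (aC _); rewrite setC_bigcup.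
  apply: (@rtrig_approx_cvg _ (fun n z => \prod_(i < n) \1_(~` A i) z) _ 1).
  + elim=> [|n IH].
      under eq_fun do rewrite big_ord0; exact: rtrig_approx_cst.
    under eq_fun do rewrite big_ord_recr /=; apply: rtrig_approxM => //.
    exact: aC (aA n).
  + move=> n z; rewrite normr_prod; elim: n => [|n IH]; first by rewrite big_ord0.
    rewrite big_ord_recr /= mulr_ile1 ?prodr_ge0 //.
    by rewrite indicE normr_nat lern1 leq_b1.
  + move=> z; have [zA|zA] := pselect ((\bigcap_i ~` A i) z).
      rewrite indicE mem_set //; apply: cvg_near_cst; apply: nearW => n.
      by rewrite big1 // => i _; rewrite indicE mem_set //; exact: zA.
    rewrite indicE memNset //; apply: cvg_near_cst.
    move: zA; rewrite -setC_bigcup /= => /contrapT [i _ Aiz].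
    (* The product of the first n indicators contains the vanishing factor of index i once n is at
       least i + 1. *)
    exists i.+1 => // n /= ni; rewrite (bigD1 (Ordinal ni)) //= indicE memNset ?mul0r //.
Qed.

Lemma sigma_algebra_preimage_system (T T' : Type) (phi : T -> T') (G : set (set T)) :
  sigma_algebra setT G -> sigma_algebra setT [set B | G (phi @^-1` B)].
Proof.
move=> [G0 GC GU]; split=> /=.
- by rewrite preimage_set0.
- by move=> A GA; rewrite setTD preimage_setC -setTD; exact: GC.
- by move=> A GA; rewrite preimage_bigcup; exact: GU.
Qed.

Lemma rtrig_approx_preimage (u : circle R -> R) (B : set R) : rtrig_approx u ->
  (forall z, `|u z| <= 1) -> measurable B -> rtrig_approx (\1_(u @^-1` B)).
Proof.
move=> au u1 mB; have : (RGenOInfty.G (R:=R)).-sigma.-measurable B.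
  by rewrite -RGenOInfty.measurableE.
suff : (RGenOInfty.G (R:=R)).-sigma.-measurable `<=`
    [set B | rtrig_approx (\1_(u @^-1` B))] by apply.
apply: smallest_sub.
  exact: (sigma_algebra_preimage_system u sigma_algebra_rtrig_approx).
move=> _ [x ->] /=; rewrite (_ : _ @^-1` _ = [set z | x < u z]).
  exact: rtrig_approx_gt.
by apply/seteqP; split=> z /=; rewrite in_itv /= andbT.
Qed.

(** On the circle the conjugate of z is 1/z, so Re z = (z^2 + 1)/(2z); likewise Im z = (z^2 -
    1)/(2iz) in the next lemma. *)
Lemma rtrig_approx_Re : rtrig_approx (fun z : circle R => complex.Re (sval z)).
Proof.
have := trig_approx_tpoly (R := R) ((2^-1)%:P * ('X^2 + 1)) 1.
congr trig_approx; apply/funext => z.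
have h : sval z * Num.conj (sval z) = 1 by rewrite conjM_nsq circle_nsq.
rewrite /tpoly !hornerE /= -expi_conj /expi expr1z.
transitivity (2^-1 * (sval z * (sval z * Num.conj (sval z)) + Num.conj (sval z))).
  by ring.
rewrite h mulr1 (addcJ (sval z) : _ + Num.conj _ = _) mulKf //.
Qed.

Lemma rtrig_approx_Im : rtrig_approx (fun z : circle R => complex.Im (sval z)).
Proof.
have := trig_approx_tpoly (R := R) ((2 * 'i)^-1%:P * ('X^2 - 1)) 1.
congr trig_approx; apply/funext => z.
have h : sval z * Num.conj (sval z) = 1 by rewrite conjM_nsq circle_nsq.
rewrite /tpoly !hornerE /= -expi_conj /expi expr1z.
transitivity ((2 * 'i)^-1 * (sval z * (sval z * Num.conj (sval z)) - Num.conj (sval z))).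
  by ring.
rewrite h mulr1 (subcJ (sval z) : _ - Num.conj _ = _) [2 * _ * _]mulrAC mulKf //.
by rewrite mulf_neq0 ?pnatr_eq0 // eq_complex /= oner_eq0 andbF.
Qed.

(** Measurable sets of the circle are traces of planar Borel sets. The product sigma-algebra of the
    plane is generated by preimages of Borel sets under one coordinate, so Re z and Im z suffice. *)
Lemma rtrig_approx_indic (A : set (circle R)) : measurable A ->
  rtrig_approx (\1_A).
Proof.
move=> [B mB]; rewrite setTI => <-.
suff : measurable `<=` [set B | rtrig_approx (\1_(@circle_coord R @^-1` B))].
  by apply.
apply: smallest_sub.
  exact: (sigma_algebra_preimage_system (@circle_coord R) sigma_algebra_rtrig_approx).
move=> _ [[D mD <-]|[D mD <-]] /=; rewrite setTI.
- apply: (rtrig_approx_preimage rtrig_approx_Re _ mD) => z.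
  exact/Re_le1/circle_nsq.
- apply: (rtrig_approx_preimage rtrig_approx_Im _ mD) => z.
  exact/Im_le1/circle_nsq.
Qed.

Lemma rtrig_approx_nonneg (u : circle R -> R) B : measurable_fun setT u ->
  (forall z, 0 <= u z <= B) -> rtrig_approx u.
Proof.
move=> mu_ uB.
have mE : measurable_fun setT (EFin \o u) by exact/measurable_EFinP.
pose a := nnsfun_approx measurableT mE.
have a0 : forall z, setT z -> (0 <= (EFin \o u) z)%E.
  by move=> z _; rewrite lee_fin; case/andP: (uB z).
have ca z : a n z @[n --> \oo] --> u z.
  by have /fine_cvgP[_] := @cvg_nnsfun_approx _ _ _ _ measurableT _ mE a0 z Logic.I.
apply: (@rtrig_approx_cvg _ a _ B) => //.
- move=> n; have -> : (a n : circle R -> R) = (fun z =>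
      \sum_(y <- finmap.enum_fset (fset_set (range (a n)))) y * \1_(a n @^-1` [set y]) z).
    by apply/funext => z; rewrite [LHS]fimfunE fsbig_finite.
  apply: rtrig_approx_sum => y; apply: rtrig_approxM; first exact: rtrig_approx_cst.
  by apply: rtrig_approx_indic; exact: measurable_sfunP.
- move=> n z; rewrite ger0_norm; last exact: fun_ge0.
  apply: (@le_trans _ _ (u z)); last by case/andP: (uB z).
  apply: (cvgr_to_ge (ca z)).
  exists n => // k /= nk.
  by have /lefP := nd_nnsfun_approx measurableT mE nk.
Qed.

Lemma rtrig_approx_bounded (u : circle R -> R) B : measurable_fun setT u ->
  (forall z, `|u z| <= B) -> rtrig_approx u.
Proof.
move=> mu_ uB.
have : rtrig_approx (fun z => (u z + B) - B).
  apply: rtrig_approxB; last exact: rtrig_approx_cst.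
  apply: (@rtrig_approx_nonneg _ (B + B)); first exact: measurable_funD.
  by move=> z; have := uB z; rewrite ler_norml => /andP[h1 h2]; apply/andP; split; lra.
by under eq_fun do rewrite addrK.
Qed.

Lemma trig_approx_bounded (f : circle R -> C) B : cmeasurable f ->
  (forall z, nsq (f z) <= B) -> trig_approx f.
Proof.
move=> [m1 m2] fB.
(* From 2|x| <= x^2 + 1, which avoids a square root. *)
have sq (x : R) : x ^+ 2 <= B -> `|x| <= B + 1.
  have := sqr_ge0 (`|x| - 1); rewrite -(real_normK (num_real x)); nra.
have := trig_approxD
  (@rtrig_approx_bounded _ (B + 1) m1 _)
  (trig_approxM (trig_approx_cst 'i) (@rtrig_approx_bounded _ (B + 1) m2 _)).
under eq_fun do rewrite -complexE.
apply; move=> z; apply: sq; apply: le_trans (fB z); rewrite /nsq.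
- by rewrite lerDl sqr_ge0.
- by rewrite lerDr sqr_ge0.
Qed.

(** The truncations of [f] to |f|^2 <= n are bounded and converge to [f] in L2, with |f|^2 as
    dominating function. *)
Lemma trig_dense (f : circle R -> C) e : L2c f -> 0 < e ->
  exists P N, (sqint (fun z => (f z - tpoly P N z)%R) <= e%:E)%E.
Proof.
move=> Lf e0; have mf := Lf.1.
pose E n := [set z | nsq (f z) <= n%:R].
have mE n : measurable (E n).
  have := measurable_nsq mf measurableT (measurable_itv `]-oo, n%:R]).
  by rewrite setTI; congr measurable; apply/seteqP; split => z /=; rewrite in_itv.
pose h n z := f z * (\1_(E n) z)%:C.
have mh n : cmeasurable (h n).
  by apply: cmeasurableM => //; apply: cmeasurable_real; exact: measurable_indic.
have [|||||n hn] := @sqint_cvg0 _ (fun n z => f z - h n z)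
  (fun z => nsq (f z)) _ _ _ _ (e / 4).
- by move=> n; exact: cmeasurableB.
- exact: integrable_nsq.
- move=> n z; rewrite /h /= indicE; case: (z \in _).
    by rewrite mulr1 subrr nsq0 nsq_ge0.
  by rewrite mulr0 subr0.
- move=> z; apply: cvg_near_cst; near=> n.
  rewrite /h indicE mem_set ?mulr1 ?subrr ?nsq0 //.
  by rewrite /E /=; near: n; exact: nbhs_infty_ger.
- by rewrite divr_gt0.
have th : trig_approx (h n).
  apply: (@trig_approx_bounded _ n%:R) => // z; rewrite /h indicE.
  have [zE|zE] := boolP (z \in E n); last by rewrite mulr0 nsq0.
  by rewrite mulr1; move/set_mem: zE.
have [mh' _ /(_ (e / 4)) [|P [N PN]]] := th; first by rewrite divr_gt0.
exists P, N.
have -> : (fun z => f z - tpoly P N z) =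
    (fun z => (f z - h n z) + (h n z - tpoly P N z)).
  by apply/funext => z; rewrite addrA subrK.
apply: le_trans (sqintD_le _ _) _.
- exact: cmeasurableB.
- exact: cmeasurableB (cmeasurable_tpoly _ _).
rewrite (_ : e%:E = 2%:E * (e / 4)%:E + 2%:E * (e / 4)%:E)%E.
  by rewrite leeD // lee_pmul2l.
by rewrite -!EFinM -EFinD; congr EFin; field.
Unshelve. all: by end_near. Qed.

Lemma parseval (f : circle R -> C) : L2c f ->
  (\esum_(n in [set: int]) (nsq (cip f (expi n)))%:E = sqint f)%E.
Proof.
move=> Lf; apply/eqP; rewrite eq_le; apply/andP; split.
  apply: ub_ereal_sup => _ [X [finX _] <-].
  rewrite fsbig_finite //= sumEFin -sqint_fineK // lee_fin.
  exact: (bessel_orthonormal (@L2c_expi R) (@expi_orthonormal R) (finmap.fset_uniq _) Lf).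
apply/lee_addgt0Pr => e e0.
have [P [N PN]] := trig_dense Lf e0.
(* The frequencies of the approximant. They form a finite set, over which the sum of |cip f (expi
   n)|^2 already reaches the squared norm of [f] up to e. *)
pose s := [seq i%:Z - N%:Z | i <- iota 0 (size P)].
have us : uniq s.
  by rewrite map_inj_uniq ?iota_uniq // => i j /addIr [].
have Lp : L2c (fun z => f z - tpoly P N z).
  split; last exact: le_lt_trans PN (ltry _).
  exact: cmeasurableB Lf.1 (cmeasurable_tpoly _ _).
have := orthonormal_approx (@L2c_expi R) (@expi_orthonormal R)
  (fun i => P`_(absz (i + N%:Z))) us Lf.
have -> : (fun z => f z - \sum_(i <- s) P`_(absz (i + N%:Z)) * expi i z) =
    (fun z => f z - tpoly P N z) by apply/funext => z; rewrite tpolyE.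
rewrite -lee_fin EFinD !sqint_fineK // => /le_trans; apply.
apply: leeD => //; apply: esum_ge; exists [set` s].
  by split; [exact: finite_seq | exact: subsetT].
by rewrite -fsbig_seq // sumEFin.
Qed.

End trig_density_sets.

(** * Orthogonal projection matrices *)

Section vectors.
Local Open Scope sesquilinear_scope.
Variable R : realType.
Local Notation C := (R[i]).

Definition vnsq m (v : 'cV[C]_m) : R := \sum_(i < m) nsq (v i ord0).

Lemma vnsq_ge0 m (v : 'cV[C]_m) : 0 <= vnsq v.
Proof. by apply: sumr_ge0 => i _; exact: nsq_ge0. Qed.

Lemma vnsq0 m : vnsq (0 : 'cV[C]_m) = 0.
Proof. by apply: big1 => i _; rewrite mxE nsq0. Qed.

Lemma vnsq_eq0 m (v : 'cV[C]_m) : vnsq v = 0 -> v = 0.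
Proof.
move=> /eqP; rewrite psumr_eq0; last by move=> i _; exact: nsq_ge0.
move=> /allP h; apply/matrixP => i j; rewrite ord1 mxE.
by apply: nsq_eq0; apply/eqP/h; rewrite mem_index_enum.
Qed.

Lemma nsq_le_vnsq m (v : 'cV[C]_m) i : nsq (v i ord0) <= vnsq v.
Proof.
rewrite /vnsq (bigD1 i) //= lerDl sumr_ge0 // => j _; exact: nsq_ge0.
Qed.

Lemma vnsqD_le m (v w : 'cV[C]_m) : vnsq (v + w) <= 2 * vnsq v + 2 * vnsq w.
Proof.
rewrite /vnsq !mulr_sumr -big_split /=; apply: ler_sum => i _.
by rewrite mxE nsqD_le.
Qed.

Lemma vnsqZ m (c : C) (v : 'cV[C]_m) : vnsq (c *: v) = nsq c * vnsq v.
Proof. by rewrite /vnsq mulr_sumr; apply: eq_bigr => i _; rewrite mxE nsqM. Qed.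

Lemma adjmxM m n p (A : 'M[C]_(m, n)) (B : 'M[C]_(n, p)) :
  (A *m B) ^t* = (B ^t*) *m (A ^t*).
Proof. by rewrite trmx_mul map_mxM. Qed.

Lemma adjmxK m n (A : 'M[C]_(m, n)) : (A ^t*) ^t* = A.
Proof. by apply/matrixP => i j; rewrite !mxE conjCK. Qed.

Lemma adjmx_vnsq m (v : 'cV[C]_m) : ((v ^t*) *m v) ord0 ord0 = (vnsq v)%:C.
Proof.
rewrite mxE /vnsq rmorph_sum; apply: eq_bigr => i _.
by rewrite !mxE mulrC conjM_nsq.
Qed.

Lemma vnsq_mulmx_le m n (A : 'M[C]_(m, n)) (K : R) (v : 'cV[C]_n) : 0 <= K ->
  (forall i j, nsq (A i j) <= K) ->
  vnsq (A *m v) <= m%:R * (2 ^+ n * K) * vnsq v.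
Proof.
move=> K0 AK; rewrite -mulrA mulr_natl -[X in _ *+ X]card_ord -sumr_const.
apply: ler_sum => i _; rewrite mxE; apply: le_trans (nsq_sum_le _ _) _.
have -> : size (index_enum 'I_n) = n by rewrite -[RHS]card_ord cardT enumT.
rewrite -mulrA ler_wpM2l ?exprn_ge0 //.
rewrite mulr_sumr; apply: ler_sum => j _.
by rewrite nsqM ler_wpM2r ?nsq_ge0.
Qed.

Lemma quadratic_mulmx_adj m n (F : 'M[C]_(m, n)) (v : 'cV[C]_m) :
  ((v ^t*) *m (F *m (F ^t*)) *m v) ord0 ord0 = (vnsq ((F ^t*) *m v))%:C.
Proof. by rewrite -adjmx_vnsq adjmxM adjmxK !mulmxA. Qed.

Section projection.
Variables (m : nat) (S : 'M[C]_m).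
(** One identity encodes an orthogonal projection: its left side is self-adjoint, so taking adjoints
    gives S^* S = S, whence S = S^* and S S = S. It is the form in which orthogonality of S u and v
    - S v appears. *)
Hypothesis SS : (S ^t*) *m S = S ^t*.

Lemma proj_hermitian : S ^t* = S.
Proof. by have := congr1 (fun A => A ^t*) SS; rewrite adjmxM adjmxK SS. Qed.

Lemma proj_idem : S *m S = S.
Proof. by have := SS; rewrite proj_hermitian. Qed.

Lemma quadratic_coproj (v : 'cV[C]_m) :
  ((v ^t*) *m (1%:M - S) *m v) ord0 ord0 = (vnsq (v - S *m v))%:C.
Proof.
rewrite -adjmx_vnsq; congr (fun_of_matrix _ _ _).
have -> : v - S *m v = (1%:M - S) *m v by rewrite mulmxBl mul1mx.
have a1 : (1%:M - S) ^t* = 1%:M - S.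
  rewrite raddfB /= map_mxB trmx1 map_mx1 -/(S ^t*) proj_hermitian //.
rewrite adjmxM a1 !mulmxA -[_ *m (1%:M - S) *m (1%:M - S)]mulmxA.
congr (_ *m _ *m _).
by rewrite mulmxBr mulmx1 mulmxBl mul1mx proj_idem subrr subr0.
Qed.

Lemma vnsq_proj_split (v : 'cV[C]_m) :
  vnsq v = vnsq (S *m v) + vnsq (v - S *m v).
Proof.
apply: (complexI (R := R)); rewrite rmorphD /= -quadratic_coproj -!adjmx_vnsq.
rewrite adjmxM proj_hermitian !mulmxA -[_ *m S *m S]mulmxA proj_idem.
transitivity (((v ^t*) *m S *m v + (v ^t*) *m (1%:M - S) *m v) ord0 ord0).
  by rewrite -mulmxDl -mulmxDr addrCA subrr addr0 mulmx1.
by rewrite mxE.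
Qed.

(** Put a = |S v|^2, b = |v - S v|^2 and X = |F^* v|^2. Writing S v = v - (v - S v) gives delta^2 a
    <= 2 X + 2 K b. Hence eta^2 (2 K + 3)(a + b) <= delta^2 a + b <= 2 X + (2 K + 1) b <= (2 K +
    3)(X + b), and a + b = |v|^2. *)
Lemma loewner_of_proj_bound n (F : 'M[C]_(m, n)) (K delta eta : R) :
  0 <= K -> (forall v, vnsq ((F ^t*) *m v) <= K * vnsq v) ->
  (forall v, delta ^+ 2 * vnsq (S *m v) <= vnsq ((F ^t*) *m (S *m v))) ->
  eta ^+ 2 * (2 * K + 3) <= delta ^+ 2 -> eta ^+ 2 * (2 * K + 3) <= 1 ->
  loewner_ge (F *m (F ^t*) + (1%:M - S)) ((eta ^+ 2)%:C)%:M.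
Proof.
move=> K0 FK Fd e1 e2 v.
have -> : ((v ^t*) *m (F *m (F ^t*) + (1%:M - S) - ((eta ^+ 2)%:C)%:M) *m v) ord0 ord0
   = (vnsq ((F ^t*) *m v) + vnsq (v - S *m v) - eta ^+ 2 * vnsq v)%:C.
  move: (eta ^+ 2) => e.
  rewrite rmorphB rmorphD rmorphM /= -quadratic_mulmx_adj -quadratic_coproj -adjmx_vnsq.
  rewrite mulmxBr mulmxBl mulmxDr mulmxDl mul_mx_scalar -scalemxAl.
  by rewrite mxE [X in X + _]mxE [X in _ + X]mxE [X in _ - X]mxE.
rewrite lecR subr_ge0 (vnsq_proj_split v).
set a := vnsq (S *m v); set b := vnsq (v - S *m v).
have a0 : 0 <= a := vnsq_ge0 _; have b0 : 0 <= b := vnsq_ge0 _.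
have h1 := Fd v; rewrite -/a in h1.
have h2 : vnsq ((F ^t*) *m (S *m v)) <= 2 * vnsq ((F ^t*) *m v) + 2 * (K * b).
  have -> : S *m v = v + - (v - S *m v) by rewrite opprB addrC subrK.
  rewrite mulmxDr; apply: le_trans (vnsqD_le _ _) _; rewrite lerD2l ler_pM2l //.
  apply: le_trans (FK _) _; rewrite -scaleN1r vnsqZ nsqN /nsq /= expr1n expr0n.
  by rewrite addr0 mul1r.
have X0 : 0 <= vnsq ((F ^t*) *m v) := vnsq_ge0 _.
set X := vnsq ((F ^t*) *m v) in h2 X0 *.
have k3 : 0 < 2 * K + 3 by rewrite ltr_wpDl // mulr_ge0.
rewrite -(ler_pM2l k3).
have : eta ^+ 2 * (2 * K + 3) * a <= delta ^+ 2 * a by rewrite ler_wpM2r.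
have : eta ^+ 2 * (2 * K + 3) * b <= 1 * b by rewrite ler_wpM2r.
have : 0 <= K * X by rewrite mulr_ge0.
nra.
Qed.

End projection.

(** * Density of vectors with rational coordinates *)

Section rational_density.

Definition ccvg (c_ : nat -> C) (c : C) :=
  (complex.Re (c_ n) @[n --> \oo] --> complex.Re c) /\
  (complex.Im (c_ n) @[n --> \oo] --> complex.Im c).

Lemma ccvgMl (a : C) c_ c : ccvg c_ c -> ccvg (fun n => a * c_ n) (a * c).
Proof.
case: a => x y [c1 c2]; split.
- have -> : complex.Re ((x +i* y) * c) = x * complex.Re c - y * complex.Im c.
    by case: c {c1 c2}.
  have -> : (fun n => complex.Re ((x +i* y) * c_ n)) =
      (fun n => x * complex.Re (c_ n) - y * complex.Im (c_ n)).
    by apply/funext => n; case: (c_ n).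
  by apply: cvgB; apply: cvgM => //; exact: cvg_cst.
- have -> : complex.Im ((x +i* y) * c) = x * complex.Im c + y * complex.Re c.
    by case: c {c1 c2}.
  have -> : (fun n => complex.Im ((x +i* y) * c_ n)) =
      (fun n => x * complex.Im (c_ n) + y * complex.Re (c_ n)).
    by apply/funext => n; case: (c_ n).
  by apply: cvgD; apply: cvgM => //; exact: cvg_cst.
Qed.

Lemma cvg_sumr (I : Type) (s : seq I) (F_ : I -> nat -> R) (F : I -> R) :
  (forall i, F_ i n @[n --> \oo] --> F i) ->
  \sum_(i <- s) F_ i n @[n --> \oo] --> \sum_(i <- s) F i.
Proof.
move=> cF; elim: s => [|i s IH].
  by rewrite big_nil; under eq_fun do rewrite big_nil; exact: cvg_cst.
by rewrite big_cons; under eq_fun do rewrite big_cons; exact: cvgD.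
Qed.

Lemma ccvg_sum (I : Type) (s : seq I) (F_ : I -> nat -> C) (F : I -> C) :
  (forall i, ccvg (F_ i) (F i)) ->
  ccvg (fun n => \sum_(i <- s) F_ i n) (\sum_(i <- s) F i).
Proof.
move=> cF; split; rewrite raddf_sum; under eq_fun do rewrite raddf_sum;
  by apply: cvg_sumr => i; have [] := cF i.
Qed.

Lemma cvg_nsq c_ c : ccvg c_ c -> nsq (c_ n) @[n --> \oo] --> nsq c.
Proof. by case=> c1 c2; apply: cvgD; rewrite !expr2; apply: cvgM. Qed.

Lemma cvg_vnsq_mulmx m n (A : 'M[C]_(m, n)) (v_ : nat -> 'cV[C]_n)
    (v : 'cV[C]_n) :
  (forall i, ccvg (fun k => v_ k i ord0) (v i ord0)) ->
  vnsq (A *m v_ k) @[k --> \oo] --> vnsq (A *m v).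
Proof.
move=> cv; apply: cvg_sumr => i; apply: cvg_nsq; rewrite mxE.
under eq_fun do rewrite mxE.
by apply: ccvg_sum => j; exact: ccvgMl.
Qed.

Definition ratvec m (q : 'cV[rat]_m * 'cV[rat]_m) : 'cV[C]_m :=
  \col_i (ratr (q.1 i ord0) +i* ratr (q.2 i ord0)).

Lemma rat_approx (x : R) (n : nat) : exists q : rat, `|x - ratr q| <= n.+1%:R^-1.
Proof.
have [|q] := @rat_in_itvoo R (x - n.+1%:R^-1) (x + n.+1%:R^-1).
  by rewrite ltrBlDr -addrA ltrDl addr_gt0 // invr_gt0 ltr0n.
rewrite in_itv /= => /andP[h1 h2]; exists q.
move: h1 h2; move: (n.+1%:R^-1 : R) (ratr q : R) => a b h1 h2.
by rewrite ler_norml; apply/andP; split; lra.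
Qed.

Lemma ratvec_dense m (v : 'cV[C]_m) : exists q_ : nat -> 'cV[rat]_m * 'cV[rat]_m,
  forall i, ccvg (fun n => ratvec (q_ n) i ord0) (v i ord0).
Proof.
pose q (x : R) n := xchoose (rat_approx x n).
have cq x : ratr (q x n) @[n --> \oo] --> x.
  apply/cvgrPdist_le => e e0; near=> n.
  apply: le_trans (xchooseP (rat_approx x n)) _.
  by apply: ltW; near: n; exact: (near_infty_natSinv_lt (PosNum e0)).
exists (fun n => (\col_i q (complex.Re (v i ord0)) n,
                  \col_i q (complex.Im (v i ord0)) n)).
move=> i; split; under eq_fun do rewrite !mxE /= ?mxE; exact: cq.
Unshelve. all: by end_near. Qed.

(** Both sides are continuous in the vector. This extends to all [v] an inequality that, almost
    everywhere, can be obtained only for countably many vectors at once. *)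
Lemma vnsq_le_ratvec m n p (A : 'M[C]_(n, m)) (B : 'M[C]_(p, m)) (c : R) :
  (forall q, c * vnsq (A *m ratvec q) <= vnsq (B *m ratvec q)) ->
  forall v, c * vnsq (A *m v) <= vnsq (B *m v).
Proof.
move=> h v; have [q_ cq] := ratvec_dense v.
rewrite -subr_ge0; apply: (@cvgr_to_ge _ \oo _ _
  (fun k => vnsq (B *m ratvec (q_ k)) - c * vnsq (A *m ratvec (q_ k)))).
  apply: cvgB; first exact: cvg_vnsq_mulmx.
  by apply: cvgM; [exact: cvg_cst | exact: cvg_vnsq_mulmx].
by apply: nearW => k; rewrite subr_ge0.
Qed.

End rational_density.
End vectors.

(** * Vector-valued L2 functions *)

Section vector_L2.
Local Open Scope sesquilinear_scope.
Variable R : realType.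
Local Notation mu := (@circle_measure R).
Local Notation C := (R[i]).

Lemma L2normsqE m (h : circle R -> 'cV[C]_m) :
  L2normsq h = (\int[mu]_z (vnsq (h z))%:E)%E.
Proof.
rewrite /L2normsq /vnsq; under eq_integral => z _.
  under eq_bigr do rewrite -nsqE.
  over.
by [].
Qed.

Lemma L2normsq_ge0 m (h : circle R -> 'cV[C]_m) : (0 <= L2normsq h)%E.
Proof. by rewrite L2normsqE; apply: integral_ge0 => z _; rewrite lee_fin vnsq_ge0. Qed.

Lemma measurable_vnsq m (h : circle R -> 'cV[C]_m) :
  (forall i, cmeasurable (fun z => h z i ord0)) ->
  measurable_fun setT (fun z => vnsq (h z)).
Proof. by move=> mh; apply: measurable_sum => i; exact: measurable_nsq. Qed.

Lemma integrable_vnsq m (h : circle R -> 'cV[C]_m) : L2 h ->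
  mu.-integrable setT (EFin \o (fun z => vnsq (h z))).
Proof.
move=> [mh h_fin]; apply/integrableP; split.
  by apply/measurable_EFinP; exact: measurable_vnsq.
rewrite L2normsqE in h_fin.
rewrite (eq_integral (fun z => (vnsq (h z))%:E)) // => z _ /=.
by rewrite ger0_norm // vnsq_ge0.
Qed.

Lemma L2normsq_fineK m (h : circle R -> 'cV[C]_m) : L2 h ->
  (fine (L2normsq h))%:E = L2normsq h.
Proof. by move=> [_ h_fin]; rewrite fineK // ge0_fin_numE // L2normsq_ge0. Qed.

Lemma L2_coord m (h : circle R -> 'cV[C]_m) i : L2 h -> L2c (fun z => h z i ord0).
Proof.
move=> Lh; apply: (L2c_dominated (Lh.1 i) (integrable_vnsq Lh)) => z.
exact: nsq_le_vnsq.
Qed.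

Lemma L2_of_coord m (h : circle R -> 'cV[C]_m) :
  (forall i, L2c (fun z => h z i ord0)) -> L2 h.
Proof.
move=> Lh; split; first by move=> i; exact: (Lh i).1.
rewrite L2normsqE /vnsq; under eq_integral do rewrite -sumEFin.
rewrite ge0_integral_sum //.
- by apply: lte_sum_pinfty => i _; exact: (Lh i).2.
- by move=> i; apply/measurable_EFinP/measurable_nsq; exact: (Lh i).1.
- by move=> i z _; rewrite lee_fin nsq_ge0.
Qed.

Lemma L2B m (f g : circle R -> 'cV[C]_m) : L2 f -> L2 g ->
  L2 (fun z => f z - g z).
Proof.
move=> Lf Lg; apply: L2_of_coord => i; under eq_fun do rewrite !mxE.
by apply: L2cB; exact: L2_coord.
Qed.

Lemma cintegrable_dot m (f g : circle R -> 'cV[C]_m) : L2 f -> L2 g ->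
  cintegrable (fun z => ((g z ^t*) *m f z) ord0 ord0).
Proof.
move=> Lf Lg; under eq_fun do rewrite mxE.
apply: cintegrable_sum => i; under eq_fun do rewrite !mxE mulrC.
by apply: cintegrable_mulconj; exact: L2_coord.
Qed.

Lemma L2_of_ae_le m n (h : circle R -> 'cV[C]_m) (f : circle R -> 'cV[C]_n) (K : R) :
  (forall i, cmeasurable (fun z => f z i ord0)) -> L2 h -> 0 <= K ->
  {ae mu, forall z, vnsq (f z) <= K * vnsq (h z)} ->
  L2 f /\ (L2normsq f <= K%:E * L2normsq h)%E.
Proof.
move=> mf Lh K0 fh.
have mh : measurable_fun setT (fun z => (vnsq (h z))%:E).
  by apply/measurable_EFinP; exact: measurable_vnsq Lh.1.
have le_fh : (L2normsq f <= K%:E * L2normsq h)%E.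
  rewrite !L2normsqE -ge0_integralZl //; last first.
    by move=> z _; rewrite lee_fin vnsq_ge0.
  apply: ae_ge0_le_integral => //.
  - by move=> z _; rewrite lee_fin vnsq_ge0.
  - by apply/measurable_EFinP; exact: measurable_vnsq.
  - by move=> z _; rewrite -EFinM lee_fin mulr_ge0 // vnsq_ge0.
  - exact: measurable_funeM.
  - by apply: filterS fh => z hz _; rewrite -EFinM lee_fin.
split=> //; split=> //; apply: le_lt_trans le_fh _.
by rewrite -L2normsq_fineK // -EFinM ltry.
Qed.

Lemma L2_of_bounded m (h : circle R -> 'cV[C]_m) (B : R) :
  (forall i, cmeasurable (fun z => h z i ord0)) -> (forall z, vnsq (h z) <= B) ->
  L2 h.
Proof.
move=> mh hB; split=> //; rewrite L2normsqE; apply: integrable_lty => //.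
apply: (@integrable_of_bounded _ _ _ _ _ B); first exact: circle_measure_lty.
  exact: measurable_vnsq.
by move=> z; rewrite ger0_norm // vnsq_ge0.
Qed.

Lemma cmeasurable_mulmx m n p (A : circle R -> 'M[C]_(m, n))
    (B : circle R -> 'M[C]_(n, p)) i j :
  (forall i j, cmeasurable (fun z => A z i j)) ->
  (forall i j, cmeasurable (fun z => B z i j)) ->
  cmeasurable (fun z => (A z *m B z) i j).
Proof.
move=> mA mB; under eq_fun do rewrite mxE.
by apply: cmeasurable_sum => l; exact: cmeasurableM.
Qed.

Lemma cmeasurable_adj m n (A : circle R -> 'M[C]_(m, n)) i j :
  (forall i j, cmeasurable (fun z => A z i j)) ->
  cmeasurable (fun z => (A z ^t*) i j).
Proof. by move=> mA; under eq_fun do rewrite !mxE; exact: cmeasurable_conj. Qed.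

(** The exceptional set is the union of those of the finitely many entries; it is therefore the same
    for all [v], and [v] may depend on z. *)
Lemma Linfty_bound m n (G : circle R -> 'M[C]_(m, n)) : Linfty G ->
  exists2 K : R, 0 <= K &
    {ae mu, forall z, forall v, vnsq (G z *m v) <= K * vnsq v}.
Proof.
move=> [_ [c Gc]]; exists (m%:R * (2 ^+ n * c ^+ 2)).
  by apply: mulr_ge0 => //; apply: mulr_ge0; [exact: exprn_ge0 | exact: sqr_ge0].
have Gc' : {ae mu, forall z, forall i j, Normc.normc (G z i j) <= c}.
  by apply: filter_forall => i; apply: filter_forall => j; exact: Gc.
apply: filterS Gc' => z Gz v; apply: vnsq_mulmx_le; first exact: sqr_ge0.
move=> i j; rewrite nsqE; have n0 : 0 <= Normc.normc (G z i j).
  by case: (G z i j) => a b /=; exact: sqrtr_ge0.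
by rewrite ler_pXn2r ?nnegrE // ?Gz // (le_trans n0 (Gz i j)).
Qed.

Lemma Linfty_adj m n (G : circle R -> 'M[C]_(m, n)) : Linfty G -> Linfty (mxadj G).
Proof.
move=> [mG [c Gc]]; split; first by move=> i j; exact: cmeasurable_adj.
exists c => i j; apply: filterS (Gc j i) => z; rewrite !mxE.
by case: (G z j i) => a b /=; rewrite sqrrN.
Qed.

Lemma L2_mulop m n (G : circle R -> 'M[C]_(m, n)) h : Linfty G -> L2 h ->
  L2 (mulop G h).
Proof.
move=> LG Lh; have [K K0 GK] := Linfty_bound LG.
have [] // := @L2_of_ae_le _ _ h (mulop G h) K.
- move=> i; apply: cmeasurable_mulmx => [|j k]; first exact: LG.1.
  by rewrite ord1; exact: Lh.1.
- by apply: filterS GK => z; exact.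
Qed.

Lemma L2normsq0_ae m (h : circle R -> 'cV[C]_m) : L2 h -> L2normsq h = 0%E ->
  {ae mu, forall z, h z = 0}.
Proof.
move=> Lh; rewrite L2normsqE => h0.
have mh : measurable_fun setT (fun z => (vnsq (h z))%:E).
  by apply/measurable_EFinP; exact: measurable_vnsq Lh.1.
have : (\int[mu]_z `|(vnsq (h z))%:E| = 0)%E.
  by under eq_integral do rewrite gee0_abs ?lee_fin ?vnsq_ge0 //.
move=> /(ae_eq_integral_abs mu measurableT mh); apply: filterS => z /(_ Logic.I) [].
exact: vnsq_eq0.
Qed.

Lemma integrable_mul_indic (u : circle R -> R) (E : set (circle R)) :
  measurable E -> mu.-integrable setT (EFin \o u) ->
  mu.-integrable setT (EFin \o (fun z => u z * \1_E z)).
Proof.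
move=> mE iu; apply: (le_integrable _ _ _ iu) => //.
  apply/measurable_EFinP; apply: measurable_funM; last exact: measurable_indic.
  by apply/measurable_EFinP/(measurable_int _ iu).
move=> z _; rewrite /= lee_fin normrM indicE; case: (_ \in _);
  by rewrite ?normr1 ?normr0 ?mulr1 ?mulr0.
Qed.

(* Testing against the indicator of [u < 0]. *)
Lemma ae_ge0_of_integral (u : circle R -> R) : mu.-integrable setT (EFin \o u) ->
  (forall E : set (circle R), measurable E -> 0 <= \int[mu]_z (u z * \1_E z)) ->
  {ae mu, forall z, 0 <= u z}.
Proof.
move=> iu uE; pose E := [set z | u z < 0].
have mu_ : measurable_fun setT u by apply/measurable_EFinP/(measurable_int _ iu).
have mE : measurable E.
  have := mu_ measurableT _ (measurable_itv `]-oo, 0[).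
  by rewrite setTI; congr measurable; apply/seteqP; split => z /=; rewrite in_itv.
have iuE : mu.-integrable setT (EFin \o (fun z => u z * \1_E z)).
  exact: integrable_mul_indic.
pose w z := -1 * (u z * \1_E z).
have iw : mu.-integrable setT (EFin \o w) by exact: (integrableZl _ (-1) iuE).
have w0 z : 0 <= w z.
  rewrite /w mulN1r oppr_ge0 indicE.
  have [/set_mem zE|_] := boolP (z \in E); last by rewrite mulr0.
  by rewrite mulr1 ltW.
have iw0 : (\int[mu]_z `|(w z)%:E| = 0)%E.
  under eq_integral => z _ do rewrite gee0_abs ?lee_fin //.
  rewrite -(fineK (integrable_fin_num measurableT iw)); congr EFin.
  apply/eqP; rewrite eq_le; apply/andP; split.
    rewrite (_ : fine _ = \int[mu]_z w z) // RintegralZl // mulN1r oppr_le0.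
    exact: uE.
  by rewrite fine_ge0 // integral_ge0 // => z _; rewrite lee_fin.
have mw := measurable_int _ iw.
move: iw0 => /(ae_eq_integral_abs mu measurableT mw); apply: filterS => z /(_ Logic.I) [].
rewrite /w mulN1r => /eqP; rewrite oppr_eq0 indicE leNgt => uz.
apply/negP => uz0; move: uz; rewrite mem_set // mulr1 => /eqP uz.
by rewrite uz ltxx in uz0.
Qed.

(** The indicators are real, so the hypothesis splits into real and imaginary parts;
    [ae_ge0_of_integral] then applies to each part and to its opposite. *)
Lemma ae_eq0_of_cintegral (f : circle R -> C) : cintegrable f ->
  (forall E : set (circle R), measurable E ->
     cintegral (fun z => f z * (\1_E z)%:C) = 0) ->
  {ae mu, forall z, f z = 0}.
Proof.
move=> [i1 i2] fE.
have ge0 (u : circle R -> R) : mu.-integrable setT (EFin \o u) ->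
    (forall E : set (circle R), measurable E -> \int[mu]_z (u z * \1_E z) = 0) ->
    {ae mu, forall z, 0 <= u z}.
  by move=> iu uE; apply: ae_ge0_of_integral => // E mE; rewrite uE.
have eq0 (u : circle R -> R) : mu.-integrable setT (EFin \o u) ->
    (forall E : set (circle R), measurable E -> \int[mu]_z (u z * \1_E z) = 0) ->
    {ae mu, forall z, u z = 0}.
  move=> iu uE; have h1 := ge0 u iu uE.
  have iN : mu.-integrable setT (EFin \o (fun z => -1 * u z)).
    exact: (integrableZl _ (-1) iu).
  have h2 : {ae mu, forall z, 0 <= -1 * u z}.
    apply: ge0 => // E mE; under eq_Rintegral do rewrite -mulrA.
    by rewrite RintegralZl ?uE ?mulr0 //; exact: integrable_mul_indic.
  apply: filterS2 h1 h2 => z a b; apply/eqP; rewrite eq_le a andbT.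
  by move: b; rewrite mulN1r oppr_ge0.
have r1 : {ae mu, forall z, complex.Re (f z) = 0}.
  apply: eq0 => // E mE; have [+ _] := fE E mE.
  move=> <-; apply: eq_Rintegral => z _.
  by case: (f z) => a b /=; rewrite mulr0 subr0.
have r2 : {ae mu, forall z, complex.Im (f z) = 0}.
  apply: eq0 => // E mE; have [_ +] := fE E mE.
  move=> <-; apply: eq_Rintegral => z _.
  by case: (f z) => a b /=; rewrite mulr0 add0r.
by apply: filterS2 r1 r2 => z; case: (f z) => a b /= -> ->.
Qed.

End vector_L2.

(** * Frame energy as an L2 norm *)

Section energy.
Local Open Scope sesquilinear_scope.
Variable R : realType.
Local Notation mu := (@circle_measure R).
Local Notation C := (R[i]).

Definition cdot m (g h : circle R -> 'cV[C]_m) (z : circle R) : C :=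
  ((g z ^t*) *m h z) ord0 ord0.

Lemma cmeasurable_cdot m (g h : circle R -> 'cV[C]_m) :
  (forall i, cmeasurable (fun z => g z i ord0)) ->
  (forall i, cmeasurable (fun z => h z i ord0)) -> cmeasurable (cdot g h).
Proof.
move=> mg mh; apply: cmeasurable_mulmx => i j.
  by apply: cmeasurable_adj => {}i {}j; rewrite ord1; exact: mg.
by rewrite ord1; exact: mh.
Qed.

(** The frame coefficients along the orbit of [g] are the Fourier coefficients of the scalar
    function g^* h. Through this identity the family is handed over to Parseval. *)
Lemma L2inner_shift m n (g h : circle R -> 'cV[C]_m) :
  L2inner h (Ushift n g) = cip (cdot g h) (expi n).
Proof.
congr cintegral; apply/funext => z.
by rewrite /cdot /Ushift -/(expi n z) linearZ map_mxZ /= -scalemxAl mxE mulrC.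
Qed.

Lemma frame_energyE m k (g : 'I_k -> circle R -> 'cV[C]_m)
    (h : circle R -> 'cV[C]_m) :
  (frame_energy (shift_family g) h =
   \sum_(j < k) \esum_(n in [set: int]) (nsq (cip (cdot (g j) h) (expi n)))%:E)%E.
Proof.
pose a n j := (nsq (cip (cdot (g j) h) (expi n)))%:E.
have a0 n j : (0 <= a n j)%E by rewrite lee_fin nsq_ge0.
rewrite -(@esum_sum R int 'I_k setT (index_enum 'I_k) xpredT a) //.
have eI : [set: 'I_k] = [set` index_enum 'I_k].
  by apply/seteqP; split=> j //= _; exact: mem_index_enum.
transitivity (\esum_(n in [set: int]) \esum_(j in [set: 'I_k]) a n j)%E.
  rewrite esum_esum //.
  have -> : [set: int] `*`` (fun=> [set: 'I_k]) = setT by apply/seteqP; split.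
  by apply: eq_esum => -[n j] _; rewrite /a nsqE L2inner_shift.
apply: eq_esum => n _; rewrite eI esum_fset; last 2 first.
- exact: finite_seq.
- by move=> *; exact: a0.
by rewrite -fsbig_seq // index_enum_uniq.
Qed.

Lemma frame_energy_parseval m k (g : 'I_k -> circle R -> 'cV[C]_m)
    (h : circle R -> 'cV[C]_m) : (forall j, L2c (cdot (g j) h)) ->
  (frame_energy (shift_family g) h = \sum_(j < k) sqint (cdot (g j) h))%E.
Proof. by move=> Lg; rewrite frame_energyE; apply: eq_bigr => j _; exact: parseval. Qed.

(** Parseval is applied to the index [j] alone; the other generators add nonnegative terms. *)
Lemma sqint_le_frame_energy m k (g : 'I_k -> circle R -> 'cV[C]_m)
    (h : circle R -> 'cV[C]_m) j : L2c (cdot (g j) h) ->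
  (sqint (cdot (g j) h) <= frame_energy (shift_family g) h)%E.
Proof.
move=> Lg; rewrite frame_energyE -parseval // (bigD1 j) //= leeDl //.
by apply: sume_ge0 => i _; apply: esum_ge0 => n _; rewrite lee_fin nsq_ge0.
Qed.

Lemma mulop_adj_cols m k (f : 'I_k -> circle R -> 'cV[C]_m)
    (h : circle R -> 'cV[C]_m) z j :
  mulop (mxadj (mx_of_cols f)) h z j ord0 = cdot (f j) h z.
Proof.
by rewrite /mulop /cdot !mxE; apply: eq_bigr => i _; rewrite !mxE.
Qed.

Lemma sum_sqint_cdot m k (f : 'I_k -> circle R -> 'cV[C]_m)
    (h : circle R -> 'cV[C]_m) : (forall j, cmeasurable (cdot (f j) h)) ->
  (\sum_(j < k) sqint (cdot (f j) h) =
   L2normsq (mulop (mxadj (mx_of_cols f)) h))%E.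
Proof.
move=> mf; rewrite L2normsqE /sqint -ge0_integral_sum //.
- apply: eq_integral => z _; rewrite sumEFin; congr EFin.
  by apply: eq_bigr => j _; rewrite mulop_adj_cols.
- by move=> j; apply/measurable_EFinP; exact: measurable_nsq.
- by move=> j z _; rewrite lee_fin nsq_ge0.
Qed.

Lemma Linfty_cols m k (f : 'I_k -> circle R -> 'cV[C]_m) :
  (forall j, Linfty (f j)) -> Linfty (mx_of_cols f).
Proof.
move=> Lf; split.
  by move=> i j; under eq_fun do rewrite mxE; exact: (Lf j).1.
pose c j := sval (cid (Lf j).2).
exists (\sum_j `|c j|) => i j.
have := svalP (cid (Lf j).2) i ord0; rewrite -/(c j); apply: filterS => z.
rewrite mxE => /le_trans; apply; apply: le_trans (ler_norm _) _.
by rewrite (bigD1 j) //= lerDl sumr_ge0.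
Qed.

Lemma L2inner_self m (h : circle R -> 'cV[C]_m) :
  L2inner h h = (\int[mu]_z vnsq (h z))%:C.
Proof.
rewrite /L2inner /cintegral; congr (_ +i* _).
  by apply: eq_Rintegral => z _; rewrite adjmx_vnsq.
rewrite /Rintegral integral0_eq // => z _; by rewrite adjmx_vnsq.
Qed.

Lemma L2inner_gram m k (F : circle R -> 'M[C]_(m, k)) (h : circle R -> 'cV[C]_m) :
  L2inner (mulop (fun z => F z *m mxadj F z) h) h =
  (fine (L2normsq (mulop (mxadj F) h)))%:C.
Proof.
transitivity (L2inner (mulop (mxadj F) h) (mulop (mxadj F) h)).
  congr cintegral; apply/funext => z.
  by rewrite /mulop /mxadj adjmxM adjmxK !mulmxA.
by rewrite L2inner_self L2normsqE.
Qed.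

End energy.

(** * The symbol of the projection *)

Section projection_symbol.
Local Open Scope sesquilinear_scope.
Variable R : realType.
Local Notation mu := (@circle_measure R).
Local Notation C := (R[i]).
Variables (m : nat) (M : set (circle R -> 'cV[C]_m)).
Hypothesis cM : closed_subspace M.
Variable sigma : circle R -> 'M[C]_m.
Hypothesis Lsigma : Linfty sigma.
Hypothesis Psigma : is_orthoproj M (mulop sigma).

(** The constant sequence [f] converges to [g] in L2. *)
Lemma closed_subspace_ae f g : M f -> L2 g -> {ae mu, forall z, f z = g z} ->
  M g.
Proof.
move=> Mf Lg fg; apply: (closed_subspace_lim cM (u := fun=> f)) => //.
suff -> : L2normsq (fun z => f z - g z) = 0%E by exact: cvg_cst.
have Lf := closed_subspaceL2 cM Mf.
rewrite L2normsqE (@ae_eq_integral _ _ _ mu _ (fun=> 0%E)) ?integral0 //.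
- apply/measurable_EFinP/measurable_vnsq => i.
  under eq_fun do rewrite !mxE; exact: cmeasurableB (Lf.1 i) (Lg.1 i).
- apply: filterS fg => z -> _; by rewrite subrr vnsq0.
Qed.

(** The residue h - sigma h lies both in [M] and in its orthogonal complement, so it is orthogonal
    to itself. *)
Lemma mulop_proj_id h : M h -> {ae mu, forall z, sigma z *m h z = h z}.
Proof.
move=> Mh; have Lh := closed_subspaceL2 cM Mh.
have [Msh oh] := Psigma Lh.
have Mr : M (fun z => h z - mulop sigma h z).
  have := closed_subspaceD cM Mh (closed_subspaceZ cM (-1) Msh).
  by congr M; apply/funext => z; rewrite scaleN1r.
have Lr := closed_subspaceL2 cM Mr.
have := oh.2 _ Mr; rewrite L2inner_self => -[].
rewrite /Rintegral -L2normsqE => r0.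
have /(L2normsq0_ae Lr) : L2normsq (fun z => h z - mulop sigma h z) = 0%E.
  by rewrite -L2normsq_fineK // r0.
by apply: filterS => z /eqP; rewrite subr_eq0 => /eqP hz; exact/esym.
Qed.

Lemma indic_vec_L2 (E : set (circle R)) (v : 'cV[C]_m) : measurable E ->
  L2 (fun z => (\1_E z)%:C *: v).
Proof.
move=> mE; apply: (@L2_of_bounded _ _ _ (vnsq v)) => [i|z].
  under eq_fun do rewrite mxE; apply: cmeasurableM; last exact: cmeasurable_cst.
  by apply: cmeasurable_real; exact: measurable_indic.
rewrite vnsqZ nsq_real indicE; case: (_ \in _); rewrite ?expr1n ?mul1r //.
by rewrite expr0n mul0r vnsq_ge0.
Qed.

(* The relation is tested on the vectors [\1_E *: e_i] and [e_j]. *)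
Lemma symbol_projection :
  {ae mu, forall z, ((sigma z) ^t*) *m sigma z = (sigma z) ^t*}.
Proof.
pose A z := ((sigma z) ^t*) *m (1%:M - sigma z).
pose e (l : 'I_m) : 'cV[C]_m := delta_mx l ord0.
have L1 l : L2 (fun=> e l).
  by apply: (@L2_of_bounded _ _ _ (vnsq (e l))) => // l'; exact: cmeasurable_cst.
have dotA i j (z : circle R) : A z i j = ((mulop sigma (fun=> e i) z ^t*) *m
    (e j - mulop sigma (fun=> e j) z)) ord0 ord0.
  have -> : e j - mulop sigma (fun=> e j) z = (1%:M - sigma z) *m e j.
    by rewrite mulmxBl mul1mx.
  rewrite /mulop adjmxM mulmxA -[_ *m (1%:M - sigma z)]mulmxA.
  by rewrite trmx_delta map_delta_mx -rowE -colE !mxE.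
have A0 : {ae mu, forall z, forall i j, A z i j = 0}.
  apply: filter_forall => i; apply: filter_forall => j.
  apply: ae_eq0_of_cintegral.
    under eq_fun do rewrite dotA; apply: cintegrable_dot; last exact: L2_mulop.
    by apply: L2B => //; exact: L2_mulop.
  move=> E mE; have LE := indic_vec_L2 (e j) mE.
  have [_ [_ /(_ _ (Psigma (L1 i)).1)]] := Psigma LE.
  rewrite /L2inner => <-; congr cintegral; apply/funext => z.
  have -> : mulop sigma (fun z => (\1_E z)%:C *: e j) z =
      (\1_E z)%:C *: mulop sigma (fun=> e j) z by rewrite /mulop -scalemxAr.
  by rewrite -scalerBr -scalemxAr [RHS]mxE dotA mulrC.
apply: filterS A0 => z Az.
have : A z = 0 by apply/matrixP => i j; rewrite Az mxE.
by rewrite /A mulmxBr mulmx1 => /eqP; rewrite subr_eq0 => /eqP <-.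
Qed.

Lemma frame_energy_symbol k (f g : 'I_k -> circle R -> 'cV[C]_m) h :
  (forall j, M (g j)) -> (forall j, Linfty (f j)) ->
  (forall j, g j = mulop sigma (f j) %[ae mu]) -> M h ->
  frame_energy (shift_family g) h = L2normsq (mulop (mxadj (mx_of_cols f)) h).
Proof.
move=> Mg Lf gf Mh; have Lh := closed_subspaceL2 cM Mh.
have Lfh j : L2c (cdot (f j) h).
  have /(L2_coord j) := L2_mulop (Linfty_adj (Linfty_cols Lf)) Lh.
  by under eq_fun do rewrite mulop_adj_cols.
have mgh j : cmeasurable (cdot (g j) h).
  by apply: cmeasurable_cdot; [exact: (closed_subspaceL2 cM (Mg j)).1 | exact: Lh.1].
have gfh j : sqint (cdot (g j) h) = sqint (cdot (f j) h).
  apply: ae_eq_integral => //.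
  - by apply/measurable_EFinP; exact: measurable_nsq.
  - by apply/measurable_EFinP/measurable_nsq; exact: (Lfh j).1.
  - apply: filterS3 (gf j) symbol_projection (mulop_proj_id Mh) =>
      z /(_ Logic.I) gz sz hz _.
    by rewrite /cdot gz /mulop adjmxM (proj_hermitian sz) -mulmxA hz.
have Lgh j : L2c (cdot (g j) h) by split=> //; rewrite gfh; exact: (Lfh j).2.
rewrite frame_energy_parseval // -sum_sqint_cdot; last by move=> j; exact: (Lfh j).1.
by apply: eq_bigr.
Qed.

Lemma bessel_of_symbol k (f g : 'I_k -> circle R -> 'cV[C]_m) :
  (forall j, M (g j)) -> (forall j, Linfty (f j)) ->
  (forall j, g j = mulop sigma (f j) %[ae mu]) -> bessel M (shift_family g).
Proof.
move=> Mg Lf gf; have LF := Linfty_adj (Linfty_cols Lf).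
have [K K0 FK] := Linfty_bound LF.
(* K may be 0, whereas a Bessel bound has to be positive. *)
exists (K + 1); first by rewrite ltr_wpDl.
move=> h Mh; have Lh := closed_subspaceL2 cM Mh.
rewrite (frame_energy_symbol Mg Lf gf Mh).
have [||_ FhK] := @L2_of_ae_le _ _ _ h (mulop (mxadj (mx_of_cols f)) h) K _ Lh K0.
- exact: (L2_mulop LF Lh).1.
- by apply: filterS FK => z; exact.
apply: le_trans FhK _; rewrite lee_wpmul2r ?L2normsq_ge0 // lee_fin lerDl //.
Qed.

(* Test [bessel] on [\1_E *: g j], with [E] inside [vnsq (g j) <= N]: by
   Parseval it gives [\int_E (vnsq (g j))^2 <= B * \int_E vnsq (g j)]. *)
Lemma Linfty_of_bessel k (g : 'I_k -> circle R -> 'cV[C]_m) j :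
  (forall j, M (g j)) -> bessel M (shift_family g) -> Linfty (g j).
Proof.
move=> Mg [B B0 gB]; have Lg := closed_subspaceL2 cM (Mg j).
have mg := measurable_vnsq Lg.1.
pose D N := [set z | vnsq (g j z) <= N%:R].
have mD N : measurable (D N).
  have := mg measurableT _ (measurable_itv `]-oo, N%:R]).
  by rewrite setTI; congr measurable; apply/seteqP; split => z /=; rewrite in_itv.
have bnd N : {ae mu, forall z, vnsq (g j z) <= N%:R -> vnsq (g j z) <= B}.
  pose p E z : R := \1_(D N `&` E) z * vnsq (g j z).
  pose q E z : R := \1_(D N `&` E) z * vnsq (g j z) ^+ 2.
  have pq E z : 0 <= p E z <= N%:R /\ 0 <= q E z <= N%:R ^+ 2.
    rewrite /p /q indicE; have [/set_mem [zD _]|_] := boolP (z \in _).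
      rewrite !mul1r vnsq_ge0 exprn_ge0 ?vnsq_ge0 //.
      by rewrite ler_pXn2r ?nnegrE ?vnsq_ge0.
    by rewrite !mul0r lexx ler0n sqr_ge0.
  have mp E : measurable E -> measurable_fun setT (p E).
    move=> mE; apply: measurable_funM => //; apply: measurable_indic.
    exact: measurableI.
  have mq E : measurable E -> measurable_fun setT (q E).
    move=> mE; apply: measurable_funM; last exact: measurable_funX.
    by apply: measurable_indic; exact: measurableI.
  have ip E : measurable E -> mu.-integrable setT (EFin \o p E).
    move=> mE; apply: (@integrable_of_bounded _ _ _ _ _ N%:R) => //.
    - exact: circle_measure_lty.
    - exact: mp.
    - by move=> z; have [/andP[h0 h1] _] := pq E z; rewrite ger0_norm.
  have iq E : measurable E -> mu.-integrable setT (EFin \o q E).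
    move=> mE; apply: (@integrable_of_bounded _ _ _ _ _ (N%:R ^+ 2)) => //.
    - exact: circle_measure_lty.
    - exact: mq.
    - by move=> z; have [_ /andP[h0 h1]] := pq E z; rewrite ger0_norm.
  have key E : measurable E -> \int[mu]_z q E z <= B * \int[mu]_z p E z.
    move=> mE; pose h z := (\1_(D N `&` E) z)%:C *: g j z.
    have idem z : \1_(D N `&` E) z ^+ 2 = \1_(D N `&` E) z :> R.
      by rewrite indicE; case: (_ \in _); rewrite ?expr1n ?expr0n.
    have hp z : vnsq (h z) = p E z by rewrite vnsqZ nsq_real idem.
    have Lh : L2 h.
      apply: (@L2_of_bounded _ _ _ N%:R) => [i|z].
        under eq_fun do rewrite mxE; apply: cmeasurableM; last exact: Lg.1.
        by apply: cmeasurable_real; apply: measurable_indic; exact: measurableI.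
      by rewrite hp; have [/andP[]] := pq E z.
    have Mh : M h.
      (* Multiplication by [sigma] commutes with the scalar indicator and fixes [g j], so [h] agrees
         almost everywhere with its own projection. *)
      apply: (closed_subspace_ae (Psigma Lh).1 Lh).
      apply: filterS (mulop_proj_id (Mg j)) => z gz.
      by rewrite /mulop /h -scalemxAr gz.
    have cq z : nsq (cdot (g j) h z) = q E z.
      by rewrite /cdot -scalemxAr mxE adjmx_vnsq nsqM !nsq_real idem.
    have sq : sqint (cdot (g j) h) = (\int[mu]_z q E z)%:E.
      rewrite /sqint; under eq_integral do rewrite cq.
      by rewrite /Rintegral fineK //; exact: integrable_fin_num (iq E mE).
    have Lc : L2c (cdot (g j) h).
      by split; [apply: cmeasurable_cdot; [exact: Lg.1 | exact: Lh.1] | rewrite sq ltry].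
    have := le_trans (sqint_le_frame_energy Lc) (gB h Mh).
    rewrite sq L2normsqE; under eq_integral do rewrite hp.
    rewrite -(fineK (integrable_fin_num measurableT (ip E mE))).
    by rewrite -EFinM lee_fin.
  have iu : mu.-integrable setT (EFin \o (fun z => B * p setT z - q setT z)).
    exact: eq_integrable (integrableB _ (integrableZl _ B (ip _ measurableT))
      (iq _ measurableT)).
  have u0 : {ae mu, forall z, 0 <= B * p setT z - q setT z}.
    apply: ae_ge0_of_integral => // E mE.
    have -> : \int[mu]_z ((B * p setT z - q setT z) * \1_E z) =
        \int[mu]_z (B * p E z - q E z).
      apply: eq_Rintegral => z _; rewrite /p /q setIT [in RHS]indicI /=; ring.
    have iBp : mu.-integrable setT (EFin \o (fun z => B * p E z)).
      exact: (integrableZl _ B (ip E mE)).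
    rewrite (RintegralB measurableT iBp (iq E mE)).
    by rewrite (RintegralZl B measurableT (ip E mE)) subr_ge0; exact: key.
  (* On [D N] the function is |g_j|^2 (B - |g_j|^2), which would be negative if |g_j|^2 exceeded
     B. *)
  apply: filterS u0 => z; rewrite /p /q setIT => + zN.
  rewrite indicE mem_set // !mul1r leNgt => h; rewrite leNgt; apply/negP => h'.
  move/negP: h; apply; rewrite subr_lt0 expr2 ltr_pM2r //.
  exact: lt_trans h'.
split; first by move=> i i'; rewrite ord1; exact: Lg.1.
(* The null sets for all N are united; then at each z the level N is taken above |g_j(z)|^2, and the
   truncation disappears. *)
exists (Num.sqrt B) => i i'; apply: filterS (ae_foralln bnd) => z gz.
have {}gz : vnsq (g j z) <= B.
  apply: (gz (Num.bound (vnsq (g j z)))).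
  by apply: ltW; exact: archi_boundP (vnsq_ge0 _).
have : nsq (g j z i i') <= B by rewrite ord1; exact: le_trans (nsq_le_vnsq _ _) gz.
by rewrite nsqE => /ler_wsqrtr; rewrite sqrtr_sqr; apply: le_trans; exact: ler_norm.
Qed.

Lemma symbol_bound_of_coercive k (F : circle R -> 'M[C]_(m, k)) (c : R) :
  Linfty F ->
  (forall h, M h -> (c%:E * L2normsq h <= L2normsq (mulop (mxadj F) h))%E) ->
  {ae mu, forall z, forall v,
    c * vnsq (sigma z *m v) <= vnsq ((F z ^t*) *m (sigma z *m v))}.
Proof.
move=> LF Fc; have LFa := Linfty_adj LF.
have vae (v : 'cV[C]_m) : {ae mu, forall z,
    0 <= vnsq ((F z ^t*) *m (sigma z *m v)) - c * vnsq (sigma z *m v)}.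
  have Lv : L2 (fun=> v).
    by apply: (@L2_of_bounded _ _ _ (vnsq v)) => // i; exact: cmeasurable_cst.
  have Lsv := L2_mulop Lsigma Lv; have LFsv := L2_mulop LFa Lsv.
  have ia := integrable_vnsq LFsv; have ib := integrable_vnsq Lsv.
  apply: ae_ge0_of_integral.
    exact: eq_integrable (integrableB _ ia (integrableZl _ c ib)).
  move=> E mE; have LE := indic_vec_L2 v mE.
  have := Fc _ (Psigma LE).1; rewrite !L2normsqE.
  have sc (z : circle R) : mulop sigma (fun z => (\1_E z)%:C *: v) z =
      (\1_E z)%:C *: mulop sigma (fun=> v) z by rewrite /mulop -scalemxAr.
  have idem z : \1_E z ^+ 2 = \1_E z :> R.
    by rewrite indicE; case: (_ \in _); rewrite ?expr1n ?expr0n.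
  have iaE := integrable_mul_indic mE ia; have ibE := integrable_mul_indic mE ib.
  under eq_integral do rewrite sc vnsqZ nsq_real idem mulrC.
  under [X in (_ <= X)%E]eq_integral => z _.
    rewrite {1}/mulop sc -scalemxAr vnsqZ nsq_real idem mulrC.
    over.
  rewrite -(fineK (integrable_fin_num measurableT iaE)).
  rewrite -(fineK (integrable_fin_num measurableT ibE)) -EFinM lee_fin => h.
  under eq_Rintegral do rewrite mulrBl -mulrA.
  rewrite RintegralB // ?RintegralZl // ?subr_ge0 //.
  exact: (integrableZl _ c ibE).
(* The null set in [vae] depends on the vector. Rational vectors are enumerated by [unpickle], so
   that a countable union of null sets serves them all. *)
have qae : {ae mu, forall z, forall n, forall q : 'cV[rat]_m * 'cV[rat]_m,
    unpickle n = Some q -> c * vnsq (sigma z *m ratvec R q) <=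
      vnsq ((F z ^t*) *m sigma z *m ratvec R q)}.
  apply: ae_foralln => n; case: (unpickle n) => [q|]; last by apply: aeW.
  apply: filterS (vae (ratvec R q)) => z; rewrite subr_ge0 => h _ [<-].
  by rewrite -mulmxA.
apply: filterS qae => z hz v; rewrite mulmxA.
by apply: vnsq_le_ratvec => q; exact: hz (pickleK q).
Qed.

(** The matrix inequality is evaluated at the vector h(z) and integrated; since sigma h = h almost
    everywhere, the summand 1 - sigma contributes 0. *)
Lemma coercive_of_symbol_bound k (F : circle R -> 'M[C]_(m, k)) (c : R) h :
  Linfty F -> 0 <= c ->
  {ae mu, forall z,
    loewner_ge (F z *m mxadj F z + (1%:M - sigma z)) (c%:C)%:M} ->
  M h -> (c%:E * L2normsq h <= L2normsq (mulop (mxadj F) h))%E.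
Proof.
move=> LF c0 Fc Mh; have Lh := closed_subspaceL2 cM Mh.
have LFh := L2_mulop (Linfty_adj LF) Lh.
have mh : measurable_fun setT (fun z => (vnsq (h z))%:E).
  by apply/measurable_EFinP; exact: measurable_vnsq Lh.1.
rewrite !L2normsqE -ge0_integralZl //; last by move=> z _; rewrite lee_fin vnsq_ge0.
apply: ae_ge0_le_integral => //.
- by move=> z _; rewrite -EFinM lee_fin mulr_ge0 // vnsq_ge0.
- exact: measurable_funeM.
- by move=> z _; rewrite lee_fin vnsq_ge0.
- by apply/measurable_EFinP; exact: measurable_vnsq LFh.1.
apply: filterS2 Fc (mulop_proj_id Mh) => z /(_ (h z)) + hz _.
rewrite -EFinM lee_fin mulmxBr mulmxBl mulmxDr mulmxDl.
rewrite mxE [X in X + _]mxE [X in _ + X]mxE.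
rewrite quadratic_mulmx_adj -mulmxA mulmxBl mul1mx hz subrr mulmx0 [X in _ + X - _]mxE.
rewrite mul_mx_scalar -scalemxAl [X in _ - X]mxE adjmx_vnsq addr0 -rmorphM -rmorphB /=.
by rewrite lecR subr_ge0.
Qed.

End projection_symbol.

Theorem theorem3p4 (R : realType) (m k : nat)
    (M : set (circle R -> 'cV[R[i]]_m)) (hM : doubly_invariant M)
    (sigma : circle R -> 'M[R[i]]_m) (hsigma : Linfty sigma)
    (hsigmaM : is_orthoproj M (mulop sigma))
    (g : 'I_k -> circle R -> 'cV[R[i]]_m) (hg : forall j, M (g j)) :
  (bessel M (shift_family g) <->
     exists f : 'I_k -> circle R -> 'cV[R[i]]_m,
       (forall j, Linfty (f j)) /\
       (forall j, g j = mulop sigma (f j) %[ae (@circle_measure R)])) /\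
  (forall f : 'I_k -> circle R -> 'cV[R[i]]_m,
     (forall j, Linfty (f j)) ->
     (forall j, g j = mulop sigma (f j) %[ae (@circle_measure R)]) ->
     let F := mx_of_cols f in
     let cond1 :=
       exists2 delta : R, 0 < delta &
         forall h, M h ->
           (delta ^+ 2 * fine (L2normsq h))%:C
             <= L2inner (mulop (fun z => F z *m mxadj F z) h) h in
     let cond2 :=
       exists2 eta : R, 0 < eta &
         {ae @circle_measure R, forall z,
           loewner_ge (F z *m mxadj F z + (1%:M - sigma z))
                      ((eta ^+ 2)%:C)%:M} in
     (frame M (shift_family g) <-> cond1) /\ (cond1 <-> cond2)).
Proof.
have cM : closed_subspace M by have [] := hM.
split.
  split=> [gB|[f [Lf gf]]]; last exact: (bessel_of_symbol cM hsigma hsigmaM hg Lf gf).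
  exists g; split=> j; first exact: (Linfty_of_bessel cM hsigmaM j hg gB).
  by apply: filterS (mulop_proj_id cM hsigmaM (hg j)) => z gz _; exact/esym.
move=> f Lf gf F cond1 cond2.
have LF : Linfty F := Linfty_cols Lf.
have energyE h : M h -> frame_energy (shift_family g) h = L2normsq (mulop (mxadj F) h).
  exact: (frame_energy_symbol cM hsigma hsigmaM hg Lf gf).
(* Both squared norms are finite, so the order of [C] in condition (1) and the order of the extended
   reals in the frame bounds express the same inequality. *)
have cond1E (c : R) h : M h ->
    ((c * fine (L2normsq h))%:C <= L2inner (mulop (fun z => F z *m mxadj F z) h) h) <->
    (c%:E * L2normsq h <= L2normsq (mulop (mxadj F) h))%E.
  move=> Mh; have Lh := closed_subspaceL2 cM Mh.
  rewrite L2inner_gram lecR -(L2normsq_fineK Lh).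
  by rewrite -(L2normsq_fineK (L2_mulop (Linfty_adj LF) Lh)) -EFinM lee_fin.
split; split.
- move=> [_ [A A0 gA]]; exists (Num.sqrt A); first by rewrite sqrtr_gt0.
  move=> h Mh; rewrite (sqr_sqrtr (ltW A0)); apply/(cond1E A h Mh).
  by rewrite -energyE //; exact: gA.
- move=> [d d0 Fd]; split; first exact: (bessel_of_symbol cM hsigma hsigmaM hg Lf gf).
  exists (d ^+ 2); first by rewrite exprn_gt0.
  by move=> h Mh; rewrite energyE //; apply/(cond1E _ h Mh); exact: Fd.
- move=> [d d0 Fd].
  have [K K0 FK] := Linfty_bound (Linfty_adj LF).
  have Fs : {ae @circle_measure R, forall z, forall v, d ^+ 2 * vnsq (sigma z *m v) <=
      vnsq (mxadj F z *m (sigma z *m v))}.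
    apply: (symbol_bound_of_coercive hsigma hsigmaM LF) => h Mh.
    by apply/(cond1E _ h Mh); exact: Fd.
  have k1 : 1 <= 2 * K + 3 by lra.
  (* Then eta^2 (2 K + 3) = min(d, 1)^2 / (2 K + 3). As 2 K + 3 >= 1, this is at most both d^2 and
     1, the two conditions of [loewner_of_proj_bound]. *)
  pose eta := Num.min d 1 / (2 * K + 3).
  have k0 : 0 < 2 * K + 3 by lra.
  have min0 : 0 < Num.min d 1 by rewrite lt_min d0 ltr01.
  have eta0 : 0 < eta by rewrite divr_gt0.
  have eta_le : eta ^+ 2 * (2 * K + 3) <= Num.min d 1 ^+ 2.
    rewrite expr2 -mulrA divfK ?gt_eqF // expr2 ler_wpM2r ?(ltW min0) //.
    by rewrite ler_pdivrMr // ler_peMr // ltW.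
  exists eta => //.
  apply: filterS3 FK Fs (symbol_projection hsigma hsigmaM) => z FKz Fsz sz.
  apply: (loewner_of_proj_bound sz K0 FKz Fsz); apply: le_trans eta_le _.
    by rewrite ler_pXn2r ?nnegrE ?(ltW min0) ?(ltW d0) // ge_min lexx.
  by rewrite exprn_ile1 ?(ltW min0) // ge_min lexx orbT.
- move=> [e e0 Fe]; exists e => // h Mh.
  apply/(cond1E _ h Mh).
  exact: (coercive_of_symbol_bound cM hsigmaM LF (sqr_ge0 e) Fe Mh).
Qed.
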